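(* Let $\bar x_k=(\bar\theta_k,\bar v_k,\bar\mu_k,\bar w_k)$, with $\bar\theta_k=(\theta_{1,k};\dots;\theta_{N,k})$, $\bar v_k=(v_{1,k};\dots;v_{N,k})$, $\bar\mu_k=(\mu_{1,k};\dots;\mu_{N,k})$, $\bar w_k=(w_{1,k};\dots;w_{N,k})$, be the iterates of the distributed GTD algorithm (DGTD) described in the context, run with step sizes satisfying $$\alpha_k>0\ \ \forall k\ge0,\qquad \sum_{k=0}^\infty\alpha_k=\infty,\qquad \sum_{k=0}^\infty\alpha_k^2<\infty .$$ Then, with probability one, $\mathrm{dist}(\bar x_k,\mathcal P)\to0$ as $k\to\infty$, where $\mathcal P=\{x\in C:\ -Ax-b\in N_C(x)\}$, $C=C_{\bar\theta}\times C_{\bar v}\times C_{\bar\mu}\times C_{\bar w}$, and $N_C(x)$ is the normal cone of $C$ at $x$.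
   Context: Multi-agent Markov decision process: there are $N$ agents $i\in\mathcal V=\{1,\dots,N\}$ with finite state spaces $\mathcal S_i$, finite action spaces $\mathcal A_i$, reward functions $r_i:\mathcal S_i\times\mathcal A_i\to\mathbb R$, and a discount factor $\gamma\in(0,1)$. Put $\mathcal S=\prod_i\mathcal S_i$, $\mathcal A=\prod_i\mathcal A_i$, with joint states $\bar s$ and joint actions $\bar a$; $\mathbb P[\bar s'|\bar s,\bar a]$ is the joint transition probability. Each agent has a fixed stochastic policy $\pi_i(s_i,a_i)=\mathbb P[a_i|s_i]$, and $\bar\pi(\bar s,\bar a)=\prod_i\pi_i(s_i,a_i)$. The matrix $P^{\bar\pi}\in\mathbb R^{|\mathcal S|\times|\mathcal S|}$ has $(\bar s,\bar s')$ entry $\sum_{\bar a\in\mathcal A}\mathbb P[\bar s'|\bar s,\bar a]\,\bar\pi(\bar s,\bar a)$. The expected reward $r_i^{\pi_i}(s_i)=\mathbb E_{a_i\sim\pi_i(s_i)}[r_i(s_i,a_i)]$ is regarded as a vector in $\mathbb R^{|\mathcal S|}$ whose entry at $\bar s$ is $r_i^{\pi_i}(s_i)$. Standing assumption: $P^{\bar\pi}$ is ergodic with stationary distribution $d$, $d(\bar s)>0$ for all $\bar s$; $D$ is the diagonal matrix with diagonal entries $d(\bar s)$. $\Phi\in\mathbb R^{|\mathcal S|\times q}$ has full column rank; $\phi(\bar s)\in\mathbb R^q$ denotes the transpose of the row of $\Phi$ indexed by $\bar s$; $\Pi=\Phi(\Phi^TD\Phi)^{-1}\Phi^TD$. $L$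 is the graph Laplacian ($L=H-W$, $W$ the adjacency matrix, $H$ the diagonal degree matrix) of an undirected graph $\mathcal G$ on $\mathcal V$, assumed connected; $\mathcal N_i$ is the neighbor set of node $i$. Notation: $\bar r^{\bar\pi}=(r_1^{\pi_1};\dots;r_N^{\pi_N})$ (stacked), $\bar P^{\bar\pi}=I_N\otimes P^{\bar\pi}$, $\bar L=L\otimes I_q$, $\bar D=I_N\otimes D$, $\bar\Phi=I_N\otimes\Phi$, and $$A=\begin{bmatrix}\bar\Phi^T\bar D\bar\Phi&0&0&\bar\Phi^T\bar D(I-\gamma\bar P^{\bar\pi})\bar\Phi\\0&I&0&-\bar L\\0&0&0&-\bar L\\-\bar\Phi^T(I-\gamma\bar P^{\bar\pi})^T\bar D\bar\Phi&\bar L&\bar L&0\end{bmatrix},\qquad b=\begin{bmatrix}-\bar\Phi^T\bar D\bar r^{\bar\pi}\\0\\0\\0\end{bmatrix}.$$ Reference points: $w^*\in\mathbb R^q$ is the unique solution of $\Pi\left(\frac1N\sum_i r_i^{\pi_i}+\gamma P^{\bar\pi}\Phi w^*\right)=\Phi w^*$; $\bar w^*=(w^*;\dots;w^* )$; $\bar v^*=0$; $\bar\theta^*=(\bar\Phi^T\bar D\bar\Phi)^{-1}\bar\Phi^T\bar D(\bar r^{\bar\pi}-\bar\Phi\bar w^*+\gamma\bar P^{\bar\pi}\bar\Phi\bar w^* )$; $\mathcal F=\{\bar\mu:\bar L\bar\mu=\bar\Phi^T(I-\gamma\bar P^{\bar\pi})^T\bar D\bar\Phi\bar\theta^*\}$.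 Constraint sets: $C_{\bar\theta},C_{\bar v},C_{\bar\mu},C_{\bar w}\subset\mathbb R^{Nq}$ are compact boxes (products of compact intervals) with $\bar\theta^*\in C_{\bar\theta}$, $\bar v^*\in C_{\bar v}$, $\bar w^*\in C_{\bar w}$, $C_{\bar\mu}\cap\mathcal F\ne\emptyset$. $\Gamma_{S}$ is Euclidean projection onto a closed convex set $S$, and $\mathrm{dist}(\cdot,\cdot)$ is Euclidean distance to a set. DGTD algorithm: start from an arbitrary initial point. At each step $k$, every agent $i$ obtains a sample $(\bar s,\bar a,\bar s')$ which, conditionally on the past (all samples and iterates up to the current iterate $\bar x_k$), is distributed as $\bar s\sim d$, $\bar a\sim\bar\pi(\bar s,\cdot)$, $\bar s'\sim\mathbb P[\cdot|\bar s,\bar a]$. With $\phi=\phi(\bar s)$, $\phi'=\phi(\bar s')$, $r_i^{\pi_i}=r_i^{\pi_i}(s_i)$ (values for agent $i$'s sample), it computes $$\theta_{i,k+1/2}=\theta_{i,k}-\alpha_k\left[\phi\phi^T\theta_{i,k}+\phi\phi^Tw_{i,k}-\gamma\phi(\phi')^Tw_{i,k}-\phi r_i^{\pi_i}\right],$$ $$v_{i,k+1/2}=v_{i,k}-\alpha_k\left[v_{i,k}-\left(|\mathcal N_i|w_{i,k}-\sum_{j\in\mathcal N_i}w_{j,k}\right)\right],$$ $$\mu_{i,k+1/2}=\mu_{i,k}+\alpha_k\left(|\mathcal N_i|w_{i,k}-\sum_{j\in\mathcal N_i}w_{j,k}\right),$$ $$w_{i,k+1/2}=w_{i,k}-\alpha_k\left(|\mathcal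 N_i|v_{i,k}-\sum_{j\in\mathcal N_i}v_{j,k}\right)-\alpha_k\left(|\mathcal N_i|\mu_{i,k}-\sum_{j\in\mathcal N_i}\mu_{j,k}\right)+\alpha_k\left(\phi\phi^T\theta_{i,k}-\gamma\phi'\phi^T\theta_{i,k}\right),$$ and then the iterates are projected: $\theta_{i,k+1},v_{i,k+1},\mu_{i,k+1},w_{i,k+1}$ are the $i$-th blocks of $\Gamma_{C_{\bar\theta}}(\bar\theta_{k+1/2})$, $\Gamma_{C_{\bar v}}(\bar v_{k+1/2})$, $\Gamma_{C_{\bar\mu}}(\bar\mu_{k+1/2})$, $\Gamma_{C_{\bar w}}(\bar w_{k+1/2})$ (for boxes the projection acts separately on each agent's block).
   Formalization: The intervals whose product is the box C_v are assumed nondegenerate (lower endpoint strictly below upper endpoint); the claim fails if, for example, C_v is allowed to be the single point {0}. *)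

(* Defs.v *)
From HB Require Import structures.
From mathcomp Require Import all_boot all_order all_algebra.
From mathcomp Require Import all_classical all_reals all_analysis.
From mathcomp Require Export mxtens.

Set Implicit Arguments.
Unset Strict Implicit.
Unset Printing Implicit Defensive.

Import Order.TTheory GRing.Theory Num.Theory.
Import numFieldNormedType.Exports.
Local Open Scope classical_set_scope.
Local Open Scope ring_scope.

Section Euclid.
Variables (R : realType) (n : nat).
Implicit Types (x y : 'cV[R]_n) (C : set 'cV[R]_n).

Definition dotv x y : R := \sum_i x i 0 * y i 0.

(* The norm [`|x|] of the library on matrices is the sup norm. *)
Definition enorm x : R := Num.sqrt (dotv x x).

(* Extended-real valued, so that the distance to the empty set is [+oo]. *)
Definition dist_to x C : \bar R := ereal_inf [set (enorm (x - y))%:E | y in C].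

(* A nearest point of [C]; it is unique when [C] is nonempty, closed and
   convex. *)
Definition eproj C x : 'cV[R]_n :=
  xget x [set p | C p /\ forall y, C y -> enorm (x - p) <= enorm (x - y)].

Definition normal_cone C x : set 'cV[R]_n :=
  [set z | forall y, C y -> dotv z (y - x) <= 0].

Definition box (lo hi : 'cV[R]_n) : set 'cV[R]_n :=
  [set x | forall i, lo i 0 <= x i 0 <= hi i 0].

End Euclid.

(* The position of entry [a] of block [i] is [mxtens_index (i, a)], so that
   these stacked vectors are compatible with the Kronecker product [*t]. *)
Section Blocks.
Variables (R : realType) (N q : nat).

Definition stack (f : 'I_N -> 'cV[R]_q) : 'cV[R]_(N * q) :=
  \col_k f (mxtens_unindex k).1 (mxtens_unindex k).2 0.

Definition blk (x : 'cV[R]_(N * q)) (i : 'I_N) : 'cV[R]_q :=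
  \col_a x (mxtens_index (i, a)) 0.

End Blocks.

Notation dim4 m := (m + (m + (m + m)))%N.

Section FourBlocks.
Variables (R : realType) (m n : nat).

Definition col4 (a b c d : 'M[R]_(m, n)) : 'M[R]_(dim4 m, n) :=
  col_mx a (col_mx b (col_mx c d)).

Definition row4 (a b c d : 'M[R]_(n, m)) : 'M[R]_(n, dim4 m) :=
  row_mx a (row_mx b (row_mx c d)).

Definition theta_of (x : 'M[R]_(dim4 m, n)) : 'M[R]_(m, n) := usubmx x.
Definition v_of (x : 'M[R]_(dim4 m, n)) : 'M[R]_(m, n) := usubmx (dsubmx x).
Definition mu_of (x : 'M[R]_(dim4 m, n)) : 'M[R]_(m, n) :=
  usubmx (dsubmx (dsubmx x)).
Definition w_of (x : 'M[R]_(dim4 m, n)) : 'M[R]_(m, n) :=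
  dsubmx (dsubmx (dsubmx x)).

End FourBlocks.

Definition prod4 (R : realType) (m : nat) (C1 C2 C3 C4 : set 'cV[R]_m) :
    set 'cV[R]_(dim4 m) :=
  [set x | [/\ C1 (theta_of x), C2 (v_of x), C3 (mu_of x) & C4 (w_of x)]].

Section Graph.
Variables (R : realType) (N : nat) (e : rel 'I_N).

Definition nbrs (i : 'I_N) : {set 'I_N} := [set j | e i j].

Definition adjacency_mx : 'M[R]_N := \matrix_(i, j) (e i j)%:R.
Definition degree_mx : 'M[R]_N := diag_mx (\row_i #|nbrs i|%:R).
Definition laplacian : 'M[R]_N := degree_mx - adjacency_mx.

Definition simple_graph : Prop := symmetric e /\ irreflexive e.
Definition connected_graph : Prop := forall i j, connect e i j.

End Graph.

Section MarkovChain.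
Variables (R : realType) (n : nat) (P : 'M[R]_n).

Definition irreducible_chain : Prop :=
  forall x y, exists k : nat, 0 < (P ^+ k) x y.

(* The greatest common divisor of the return times of every state is 1. *)
Definition aperiodic_chain : Prop :=
  forall x (m : nat),
    (forall k : nat, (0 < k)%N -> 0 < (P ^+ k) x x -> (m %| k)%N) -> m = 1%N.

Definition ergodic_chain : Prop := irreducible_chain /\ aperiodic_chain.

End MarkovChain.

Record mamdp (R : realType) (N : nat) := MAMDP {
  state : 'I_N -> finType;
  action : 'I_N -> finType;
  reward : forall i, state i -> action i -> R;
  (* [trans s a s'] is the probability of [s'] given [s] and [a] *)
  trans : {dffun forall i, state i} -> {dffun forall i, action i} ->
          {dffun forall i, state i} -> R;
  discount : R;
  trans_ge0 : forall s a s', 0 <= trans s a s';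
  trans_sum1 : forall s a, \sum_s' trans s a s' = 1;
  discount_gt0 : 0 < discount;
  discount_lt1 : discount < 1 }.

Section MDP.
Variables (R : realType) (N q : nat) (M : mamdp R N).

Definition jstate : finType := {dffun forall i, state M i}.
Definition jaction : finType := {dffun forall i, action M i}.

Definition nS : nat := #|jstate|.

(* Vectors and matrices indexed by joint states use [enum_rank]/[enum_val]. *)
Definition svec (f : jstate -> R) : 'cV[R]_nS := \col_x f (enum_val x).

Definition policies := forall i, state M i -> action M i -> R.

Definition is_policies (pi : policies) : Prop :=
  forall i s, (forall a, 0 <= pi i s a) /\ \sum_a pi i s a = 1.

Variable pi : policies.

Definition jpolicy (s : jstate) (a : jaction) : R := \prod_i pi (s i) (a i).

Definition Ppi : 'M[R]_nS :=
  \matrix_(x, y) \sum_(a : jaction)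
     trans (enum_val x) a (enum_val y) * jpolicy (enum_val x) a.

Definition exp_reward (i : 'I_N) (s : state M i) : R :=
  \sum_a pi s a * reward s a.

Definition reward_vec (i : 'I_N) : 'cV[R]_nS :=
  svec (fun s => exp_reward (s i)).

Definition stationary (d : jstate -> R) : Prop :=
  [/\ forall s, 0 <= d s, \sum_s d s = 1 &
      (svec d)^T *m Ppi = (svec d)^T].

(* Joint law of one sample (state, action, next state). *)
Definition sample := (jstate * jaction * jstate)%type.

Definition sample_law (d : jstate -> R) (z : sample) : R :=
  d z.1.1 * jpolicy z.1.1 z.1.2 * trans z.1.1 z.1.2 z.2.

Variables (d : jstate -> R) (Phi : 'M[R]_(nS, q)) (e : rel 'I_N).

Let gamma := discount M.

Definition Dmx : 'M[R]_nS := diag_mx (svec d)^T.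

Definition Pimx : 'M[R]_nS :=
  Phi *m invmx (Phi^T *m Dmx *m Phi) *m Phi^T *m Dmx.

Definition feature (s : jstate) : 'cV[R]_q := (row (enum_rank s) Phi)^T.

Definition bar_r : 'cV[R]_(N * nS) := stack reward_vec.
Definition bar_P : 'M[R]_(N * nS) := 1%:M *t Ppi.
Definition bar_L : 'M[R]_(N * q) := laplacian R e *t 1%:M.
Definition bar_D : 'M[R]_(N * nS) := 1%:M *t Dmx.
Definition bar_Phi : 'M[R]_(N * nS, N * q) := 1%:M *t Phi.

Definition A_mx : 'M[R]_(dim4 (N * q)) :=
  let G := bar_Phi^T *m bar_D *m bar_Phi in
  col4
    (row4 G 0 0 (bar_Phi^T *m bar_D *m (1%:M - gamma *: bar_P) *m bar_Phi))
    (row4 0 1%:M 0 (- bar_L))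
    (row4 0 0 0 (- bar_L))
    (row4 (- (bar_Phi^T *m (1%:M - gamma *: bar_P)^T *m bar_D *m bar_Phi))
       bar_L bar_L 0).

Definition b_vec : 'cV[R]_(dim4 (N * q)) :=
  col4 (- (bar_Phi^T *m bar_D *m bar_r)) 0 0 0.

(* [is_wstar], [bar_theta] and [Fset] take the reference point [w] as an
   argument; the equation of [is_wstar] has at most one solution under the
   standing assumptions. *)
Definition is_wstar (w : 'cV[R]_q) : Prop :=
  Pimx *m (N%:R^-1 *: (\sum_i reward_vec i) + gamma *: (Ppi *m Phi *m w))
  = Phi *m w.

Definition bar_w (w : 'cV[R]_q) : 'cV[R]_(N * q) := stack (fun=> w).

Definition bar_theta (w : 'cV[R]_q) : 'cV[R]_(N * q) :=
  invmx (bar_Phi^T *m bar_D *m bar_Phi) *m bar_Phi^T *m bar_D *m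
  (bar_r - bar_Phi *m bar_w w + gamma *: (bar_P *m bar_Phi *m bar_w w)).

Definition Fset (w : 'cV[R]_q) : set 'cV[R]_(N * q) :=
  [set mu | bar_L *m mu =
    bar_Phi^T *m (1%:M - gamma *: bar_P)^T *m bar_D *m bar_Phi *m bar_theta w].

Definition stationary_points (C : set 'cV[R]_(dim4 (N * q))) :
    set 'cV[R]_(dim4 (N * q)) :=
  [set x | C x /\ normal_cone C x (- (A_mx *m x) - b_vec)].

Definition lap_diff (x : 'cV[R]_(N * q)) (i : 'I_N) : 'cV[R]_q :=
  #|nbrs e i|%:R *: blk x i - \sum_(j in nbrs e i) blk x j.

(* In each half step, [alpha] is the step size, [x] the current iterate and
   [z i] the sample obtained by agent [i]. *)
Section HalfSteps.
Variables (alpha : R) (x : 'cV[R]_(dim4 (N * q))) (z : 'I_N -> sample).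

Let phi (i : 'I_N) := feature (z i).1.1.
Let phi' (i : 'I_N) := feature (z i).2.
Let theta (i : 'I_N) := blk (theta_of x) i.
Let v (i : 'I_N) := blk (v_of x) i.
Let mu (i : 'I_N) := blk (mu_of x) i.
Let w (i : 'I_N) := blk (w_of x) i.

Definition theta_half (i : 'I_N) : 'cV[R]_q :=
  theta i - alpha *:
    (phi i *m (phi i)^T *m theta i + phi i *m (phi i)^T *m w i
     - gamma *: (phi i *m (phi' i)^T *m w i)
     - exp_reward ((z i).1.1 i) *: phi i).

Definition v_half (i : 'I_N) : 'cV[R]_q :=
  v i - alpha *: (v i - lap_diff (w_of x) i).

Definition mu_half (i : 'I_N) : 'cV[R]_q :=
  mu i + alpha *: lap_diff (w_of x) i.

Definition w_half (i : 'I_N) : 'cV[R]_q :=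
  w i - alpha *: lap_diff (v_of x) i - alpha *: lap_diff (mu_of x) i
  + alpha *: (phi i *m (phi i)^T *m theta i
              - gamma *: (phi' i *m (phi i)^T *m theta i)).

End HalfSteps.

Variables Ctheta Cv Cmu Cw : set 'cV[R]_(N * q).

Definition dgtd_step alpha x z : 'cV[R]_(dim4 (N * q)) :=
  col4 (eproj Ctheta (stack (theta_half alpha x z)))
       (eproj Cv (stack (v_half alpha x)))
       (eproj Cmu (stack (mu_half alpha x)))
       (eproj Cw (stack (w_half alpha x z))).

Fixpoint dgtd (alpha : nat -> R) (T : Type) (x0 : T -> 'cV[R]_(dim4 (N * q)))
    (X : nat -> 'I_N -> T -> sample) (k : nat) (t : T) :
    'cV[R]_(dim4 (N * q)) :=
  if k is j.+1 then
    dgtd_step (alpha j) (dgtd alpha x0 X j t) (fun i => X j i t)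
  else x0 t.

End MDP.

Section Conditioning.
Variables (R : realType) (disp : measure_display) (T : measurableType disp).

(* The sigma-algebra generated by the first [k] rounds of (finitely valued)
   observations and by the coordinates of [x 0], ..., [x k]. *)
Definition past (n : nat) (I : Type) (Z : Type) (X : nat -> I -> T -> Z)
    (x : nat -> T -> 'cV[R]_n) (k : nat) : set (set T) :=
  <<s [set E | exists j i z, (j < k)%N /\ E = X j i @^-1` [set z]] `|`
      [set E | exists j c (B : set R), [/\ (j <= k)%N, measurable B &
                 E = (fun t => x j t c 0) @^-1` B]] >>.

(* [Y] is a version of the conditional probability of the event [E] given the
   sub-sigma-algebra [F]. *)
Definition is_cond_prob (P : probability T R) (F : set (set T)) (E : set T)
    (Y : T -> R) : Prop :=
  [/\ forall B : set R, measurable B -> F (Y @^-1` B),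
      P.-integrable setT (EFin \o Y) &
      forall B, F B -> P (E `&` B) = (\int[P]_(t in B) (Y t)%:E)%E].

End Conditioning.

(* Main.v *)
(* The drift [A (x - xs)], where [xs] gathers the reference points, is monotone,
   but its symmetric part only controls [theta] and [v]; in [w] and [mu] it is a
   rotation, so monotonicity alone does not give convergence.
   Probability is used once: the weighted sampling errors are bounded martingale
   differences with summable variances, so almost surely their partial sums, and
   those of their products with the coordinates of the iterates, are Cauchy. The
   rest is an argument about one such trajectory.
   Comparing squared distances to [xs] along the projected iteration gives
   [theta -> theta^*] and [v -> 0]. Since [v] relaxes towards [L w] and its box is
   not reduced to [0], every coordinate of [L w] asymptotically has a constant
   sign, hence every coordinate of [mu], driven by [L w], is asymptotically
   monotone. Taking iterates at which the corresponding linear functional of [mu]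
   is extremal, [mu] stays put during long time windows; there [w] has a nearly
   constant drift, and a second extremal choice makes [w] stay put as well. A point
   near which the iterates rest during arbitrarily long windows solves the
   variational inequality, and the squared distance to a solution being
   essentially nonincreasing, the whole sequence converges to that point. *)

Require Import Defs.
From mathcomp Require Import all_boot all_order all_algebra.
From mathcomp Require Import all_classical all_reals all_analysis.
From mathcomp Require Import measurable_realfun lra ring.

Set Implicit Arguments.
Unset Strict Implicit.
Unset Printing Implicit Defensive.

Import Order.TTheory GRing.Theory Num.Theory.
Import numFieldNormedType.Exports.
Local Open Scope classical_set_scope.
Local Open Scope ring_scope.

(** * Projected scalar recursions *)

(** Solutions are far from unique: [mu] is only tied by a linear equation in the singular matrix
    [L], so the limit depends on the trajectory. The noise is therefore summed against the
    coordinates of the iterates rather than against the difference with a fixed point; by linearity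
    one null set then serves every possible limit. Time is measured by sums of step sizes. The error
    in the monotonicity of [mu] is proportional to elapsed time, which is infinite in total, so it
    does not make [mu] converge. It is harmless only over windows of bounded time, hence the choice
    of extremal starting points. Both extremal functionals are signed sums of coordinates. When no
    signed coordinate can move one way and the sum cannot move the other way, every coordinate is
    frozen. The functional of [w] makes sense only where [mu] is already near its chosen point, so
    the two upper limits are nested, and limits are taken along indices subject to a condition [Q]
    with a tolerance. The updates of [v] and [mu] use no sample, so the sign argument is free of
    noise. The initial point may lie outside the box, so trajectories are studied from the first
    projected iterate on. *)

Section Clip.
Variable R : realType.
Implicit Types lo hi y z : R.

Definition clip lo hi y := Num.max lo (Num.min hi y).

Lemma clipP lo hi y : lo <= hi ->
  [\/ y <= lo /\ clip lo hi y = lo, lo <= y <= hi /\ clip lo hi y = y |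
      hi <= y /\ clip lo hi y = hi].
Proof.
rewrite /clip => h; case: (leP y hi) => yh.
  by case: (leP lo y) => ly; [apply: Or32|apply: Or31]; split => //; rewrite ?ltW.
by apply: Or33; split; [rewrite ltW|case: leP => //; lra].
Qed.

Lemma clip_itv lo hi y : lo <= hi -> lo <= clip lo hi y <= hi.
Proof. by move=> h; case: (clipP y h) => -[? ->]; lra. Qed.

Lemma clipN lo hi y : lo <= hi -> clip (- hi) (- lo) (- y) = - clip lo hi y.
Proof.
move=> h; have hN : - hi <= - lo by lra.
by case: (clipP y h) => -[? ->]; case: (clipP (- y) hN) => -[? ->]; lra.
Qed.

(** Clipping lowers a value only by stopping it at [hi]; this dichotomy drives all one-sided
    comparisons below. *)
Lemma clip_lb lo hi y : lo <= hi -> clip lo hi y = hi \/ y <= clip lo hi y.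
Proof. by move=> h; case: (clipP y h) => -[? ->]; by [right|left|right; lra]. Qed.

Lemma clip_dist lo hi y z : lo <= z <= hi -> `|clip lo hi y - z| <= `|y - z|.
Proof.
move=> hz; have h : lo <= hi by lra.
by case: (ger0P (y - z)) => ?; case: (ger0P (clip lo hi y - z)) => ?;
  case: (clipP y h) => -[? ?]; lra.
Qed.

Lemma clip_unique lo hi y p : lo <= p <= hi ->
  `|y - p| <= `|y - clip lo hi y| -> p = clip lo hi y.
Proof.
move=> hp; have h : lo <= hi by lra.
by case: (ger0P (y - p)) => ?; case: (ger0P (y - clip lo hi y)) => ?;
  case: (clipP y h) => -[? ?]; lra.
Qed.

Lemma clip_nearest lo hi y z : lo <= z <= hi -> `|y - clip lo hi y| <= `|y - z|.
Proof.
move=> hz; have h : lo <= hi by lra.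
by case: (ger0P (y - z)) => ?; case: (ger0P (y - clip lo hi y)) => ?;
  case: (clipP y h) => -[? ?]; lra.
Qed.

End Clip.

Section ScalarSequences.
Variable R : realType.
Implicit Types u eta : nat -> R.

(** Convergence of the series in Cauchy form: only sums over late windows are ever estimated, never
    the value of the series. *)
Definition csum u := forall eps : R, 0 < eps -> exists n, forall k m,
  (n <= k)%N -> (k <= m)%N -> `|\sum_(k <= i < m) u i| <= eps.

Definition tends0 u := forall eps : R, 0 < eps -> exists n, forall k,
  (n <= k)%N -> `|u k| <= eps.

Lemma csum0 : csum (fun=> 0).
Proof.
move=> eps e0; exists 0%N => k m _ _; rewrite big1 // normr0; exact: ltW.
Qed.

Lemma eq_csum u1 u2 : u1 =1 u2 -> csum u1 -> csum u2.
Proof. by move=> /funext ->. Qed.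

Lemma csumD u1 u2 : csum u1 -> csum u2 -> csum (fun k => u1 k + u2 k).
Proof.
move=> h1 h2 eps e0; have e20 : 0 < eps / 2 by lra.
have [n1 H1] := h1 _ e20; have [n2 H2] := h2 _ e20.
exists (maxn n1 n2) => k m; rewrite geq_max => /andP[k1 k2] km.
rewrite big_split /=; apply: le_trans (ler_normD _ _) _.
have := H1 _ _ k1 km; have := H2 _ _ k2 km; lra.
Qed.

Lemma csumZ (a : R) u : csum u -> csum (fun k => a * u k).
Proof.
move=> h eps e0; have a0 : 0 < `|a| + 1 by have := normr_ge0 a; lra.
have [n H] := h _ (divr_gt0 e0 a0); exists n => k m nk km.
rewrite -mulr_sumr normrM.
have := H _ _ nk km; rewrite ler_pdivlMr // => H1.
apply: le_trans H1; rewrite mulrC ler_wpM2l //; lra.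
Qed.

Lemma csum_sum (I : Type) (r : seq I) (P : pred I) (u : I -> nat -> R) :
  (forall i, csum (u i)) -> csum (fun k => \sum_(i <- r | P i) u i k).
Proof.
move=> h; elim: r => [|i r IH].
  by apply: eq_csum csum0 => k; rewrite big_nil.
case Pi: (P i).
  by apply: eq_csum (csumD (h i) IH) => k; rewrite big_cons Pi.
by apply: eq_csum IH => k; rewrite big_cons Pi.
Qed.

Lemma csum_bounded u (M : R) : (forall k, 0 <= u k) ->
  (forall m, \sum_(0 <= i < m) u i <= M) -> csum u.
Proof.
move=> u0 uM eps e0.
pose S := [set r : R | exists m, r = \sum_(0 <= i < m) u i]%classic.
have hS : has_sup S.
  by split; [exists 0, 0%N; rewrite big_geq | exists M => _ [m ->]].
have [_ [n ->] hn] := sup_adherent e0 hS; exists n => k m nk km.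
rewrite ger0_norm; last exact: sumr_ge0.
have ub : \sum_(0 <= i < m) u i <= sup S by apply: ub_le_sup; [case: hS|exists m].
have n0 : 0 <= \sum_(n <= i < k) u i by exact: sumr_ge0.
move: ub; rewrite (big_cat_nat (n := n)) ?(leq_trans nk) //=.
rewrite (big_cat_nat (m := n) (n := k)) //=; lra.
Qed.

Section Steps.
Variable alpha : nat -> R.
Hypothesis alpha_gt0 : forall k, 0 < alpha k.
Hypothesis alpha_div : forall k (T : R), exists m, T <= \sum_(k <= i < m) alpha i.

(** Step sizes are read as durations, so a bounded drift moves a coordinate by at most a multiple of
    the elapsed time. *)
Local Notation elapsed k m := (\sum_(k <= i < m) alpha i).

Lemma elapsed_ge0 k m : 0 <= elapsed k m.
Proof. by apply: sumr_ge0 => i _; exact: ltW. Qed.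

Lemma elapsedS k m : (k <= m)%N -> elapsed k m.+1 = elapsed k m + alpha m.
Proof. by move=> km; rewrite big_nat_recr. Qed.

Lemma elapsed_exit k (T : R) : 0 < T -> exists m, [/\ (k < m)%N, T <= elapsed k m &
  forall i, (k <= i < m)%N -> elapsed k i < T].
Proof.
move=> T0; have ex : exists m, T <= elapsed k m by have [m] := alpha_div k T; exists m.
exists (ex_minn ex); case: ex_minnP => m Tm mmin; split => //.
  by rewrite ltnNge; apply/negP => mk; move: Tm; rewrite big_geq //; lra.
move=> i /andP[_ im]; rewrite ltNge; apply/negP => /mmin; by rewrite leqNgt im.
Qed.

Lemma slow_window u (K : R) k m : 0 <= K ->
  (forall i, `|u i.+1 - u i| <= K * alpha i) -> (k <= m)%N ->
  `|u m - u k| <= K * elapsed k m.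
Proof.
move=> K0 hu; elim: m => [|m IH].
  by rewrite leqn0 => /eqP ->; rewrite subrr normr0 big_geq // mulr0.
rewrite leq_eqVlt => /orP[/eqP <-|]; first by rewrite subrr normr0 big_geq // mulr0.
rewrite ltnS => km; rewrite elapsedS // mulrDr.
have -> : u m.+1 - u k = (u m.+1 - u m) + (u m - u k) by ring.
apply: le_trans (ler_normD _ _) _; have := IH km; have := hu m; lra.
Qed.

(** A discrete Barbalat lemma. A value above [eps] stays above [eps / 2] during the time
    [t = eps / (2 * K)], and this window alone contributes [eps / 2 * t] to the series, twice what
    the Cauchy bound allows. *)
Lemma slow_summable_tends0 u (K : R) :
  (forall k, 0 <= u k) -> (forall i, `|u i.+1 - u i| <= K * alpha i) ->
  csum (fun k => alpha k * u k) -> tends0 u.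
Proof.
move=> u0 hK hs; wlog K0 : K hK / 0 < K.
  move/(_ (`|K| + 1)); apply; last by have := normr_ge0 K; lra.
  move=> i; apply: le_trans (hK i) _; rewrite ler_wpM2r ?ltW //.
  have := ler_norm K; lra.
move=> eps e0; set t := eps / (2 * K).
have t0 : 0 < t by rewrite divr_gt0 // mulr_gt0.
have Kt : K * t = eps / 2 by rewrite /t; field; lra.
have d0 : 0 < eps / 4 * t by rewrite mulr_gt0 //; lra.
have [n H] := hs _ d0; exists n => k nk; rewrite ger0_norm // leNgt; apply/negP => ku.
have [m [km tm mmin]] := elapsed_exit k t0.
have := H k m nk (ltnW km); rewrite ger0_norm; last first.
  by apply: sumr_ge0 => i _; rewrite mulr_ge0 // ltW.
have : eps / 2 * elapsed k m <= \sum_(k <= i < m) alpha i * u i.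
  rewrite mulr_sumr big_nat_cond [X in _ <= X]big_nat_cond; apply: ler_sum => i.
  rewrite andbT => kim; have := slow_window (ltW K0) hK (proj1 (andP kim)).
  have := mmin i kim; rewrite -(ltr_pM2l K0) Kt ler_norml => h1 /andP[h2 h3].
  by rewrite mulrC ler_wpM2l ?ltW //; lra.
have : eps / 2 * t <= eps / 2 * elapsed k m by rewrite ler_wpM2l //; lra.
lra.
Qed.

(** When the projection stops [z] at [hi], the lower bound holds trivially and the noise accumulated
    before is forgotten. Only the noise since that moment counts, which is why [rho] has to bound
    the sums over all later windows and not just those starting at [k]. *)
Lemma clip_drift_lb (lo hi : R) (z drift eta : nat -> R) k m (delta rho : R) :
  lo <= hi -> (forall i, lo <= z i <= hi) ->
  (forall i, z i.+1 = clip lo hi (z i + alpha i * drift i - eta i)) ->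
  0 <= delta ->
  (forall i, (k <= i < m)%N -> - delta <= drift i) ->
  (forall i j, (k <= i)%N -> (i <= j)%N -> `|\sum_(i <= l < j) eta l| <= rho) ->
  forall j, (k <= j <= m)%N -> z k - rho - delta * elapsed k j <= z j.
Proof.
move=> lohi zbox zS d0 hd hrho.
(* [i0] is the last time at which the projection was active at [hi]. *)
suff H j : (k <= j <= m)%N -> exists i0, (k <= i0 <= j)%N /\
    z k - delta * elapsed k j - \sum_(i0 <= l < j) eta l <= z j.
  move=> j /H[i0 [/andP[ki0 i0j]]].
  have := hrho i0 j ki0 i0j; rewrite ler_norml; lra.
elim: j => [|j IH].
  case/andP; rewrite leqn0 => /eqP k0 _; exists 0%N; rewrite k0 !big_geq //; split => //; lra.
case/andP; rewrite leq_eqVlt => /orP[/eqP <- _|].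
  by exists k; rewrite leqnn !big_geq //; split => //; lra.
rewrite ltnS => kj jm; rewrite elapsedS // zS.
have [->|h] := clip_lb (z j + alpha j * drift j - eta j) lohi.
  exists j.+1; rewrite leqnn (leqW kj); split => //; rewrite (big_geq (leqnn j.+1)).
  have := mulr_ge0 d0 (addr_ge0 (elapsed_ge0 k j) (ltW (alpha_gt0 j))).
  have := zbox k; lra.
have [|i0 [/andP[ki0 i0j] hi0]] := IH; first by rewrite kj ltnW.
exists i0; rewrite ki0 (leqW i0j); split => //; rewrite big_nat_recr //=.
have : alpha j * (- delta) <= alpha j * drift j.
  by apply: ler_wpM2l; [exact: ltW|apply: hd; rewrite kj].
move: h; lra.
Qed.

Lemma clip_drift_ub (lo hi : R) (z drift eta : nat -> R) k m (delta rho : R) :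
  lo <= hi -> (forall i, lo <= z i <= hi) ->
  (forall i, z i.+1 = clip lo hi (z i + alpha i * drift i - eta i)) ->
  0 <= delta ->
  (forall i, (k <= i < m)%N -> drift i <= delta) ->
  (forall i j, (k <= i)%N -> (i <= j)%N -> `|\sum_(i <= l < j) eta l| <= rho) ->
  forall j, (k <= j <= m)%N -> z j <= z k + rho + delta * elapsed k j.
Proof.
move=> lohi zbox zS d0 hd hrho j kjm.
suff : - z k - rho - delta * elapsed k j <= - z j by lra.
apply: (@clip_drift_lb (- hi) (- lo) (fun i => - z i) (fun i => - drift i)
  (fun i => - eta i) k m) => //.
- by rewrite lerN2.
- by move=> i; rewrite !lerN2 andbC.
- by move=> i; rewrite zS -clipN //; congr clip; ring.
- by move=> i /hd; rewrite lerN2.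
- by move=> i l ki il; rewrite sumrN normrN hrho.
Qed.

(* A drift that stayed positive would push [z] away from its limit. *)
Lemma relaxation_sign (lo hi : R) (z a : nat -> R) (K : R) :
  lo <= 0 -> 0 < hi -> (forall i, lo <= z i <= hi) ->
  (forall i, z i.+1 = clip lo hi (z i + alpha i * (a i - z i))) ->
  (forall i, `|a i.+1 - a i| <= K * alpha i) -> tends0 z ->
  forall eps, 0 < eps -> exists n, forall k, (n <= k)%N -> a k <= eps.
Proof.
move=> lo0 hi0 zbox zS hK hz.
wlog K0 : K hK / 0 < K.
  move/(_ (`|K| + 1)); apply; last by have := normr_ge0 K; lra.
  move=> i; apply: le_trans (hK i) _; rewrite ler_wpM2r ?ltW //.
  have := ler_norm K; lra.
move=> eps e0; set t := eps / (2 * K).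
have t0 : 0 < t by rewrite divr_gt0 // mulr_gt0.
have Kt : K * t = eps / 2 by rewrite /t; field; lra.
have et0 : 0 < eps * t by rewrite mulr_gt0.
(* Three demands on the size of [z]: [hi / 2] keeps the projection from stopping [z] at [hi],
   [eps / 4] leaves a drift of at least [eps / 4] while [a] exceeds [eps / 2], and [eps * t / 16]
   makes the resulting rise [eps / 4 * t] larger than [2 * d]. *)
pose d := Num.min (hi / 2) (Num.min (eps / 4) (eps * t / 16)).
have d0 : 0 < d by rewrite !lt_min; apply/andP; split; [lra|apply/andP; split; lra].
have [dh de dt] : [/\ d <= hi / 2, d <= eps / 4 & d <= eps * t / 16].
  by split; rewrite /d !ge_min lexx ?orbT.
have [n H] := hz _ d0; exists n => k nk; rewrite leNgt; apply/negP => ku.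
have [m [km tm mmin]] := elapsed_exit k t0.
have zd i : (k <= i)%N -> - d <= z i <= d.
  by move=> ki; rewrite -ler_norml H // (leq_trans nk).
have incr i : (k <= i < m)%N -> eps / 4 * alpha i <= z i.+1 - z i.
  move=> kim; have [ki im] := andP kim.
  have := slow_window (ltW K0) hK ki.
  have := mmin i kim; rewrite -(ltr_pM2l K0) Kt ler_norml => h1 /andP[h2 h3].
  have lohi : lo <= hi by lra.
  have [E|] := clip_lb (z i + alpha i * (a i - z i)) lohi.
    by have := zd i.+1 (leqW ki); rewrite zS E; lra.
  rewrite -zS => h; have := zd i ki => zdi.
  have : alpha i * (eps / 4) <= alpha i * (a i - z i).
    by rewrite ler_wpM2l ?ltW //; lra.
  lra.
have : eps / 4 * elapsed k m <= \sum_(k <= i < m) (z i.+1 - z i).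
  rewrite mulr_sumr big_nat_cond [X in _ <= X]big_nat_cond.
  by apply: ler_sum => i; rewrite andbT => /incr.
rewrite telescope_sumr ?(ltnW km) // => h.
have : eps / 4 * t <= eps / 4 * elapsed k m by rewrite ler_wpM2l //; lra.
have := zd k (leqnn _); have := zd m (ltnW km); lra.
Qed.

Lemma relaxation_sign_ge (lo hi : R) (z a : nat -> R) (K : R) :
  lo < 0 -> 0 <= hi -> (forall i, lo <= z i <= hi) ->
  (forall i, z i.+1 = clip lo hi (z i + alpha i * (a i - z i))) ->
  (forall i, `|a i.+1 - a i| <= K * alpha i) -> tends0 z ->
  forall eps, 0 < eps -> exists n, forall k, (n <= k)%N -> - eps <= a k.
Proof.
move=> lo0 hi0 zbox zS hK hz eps e0.
suff [n H] : exists n, forall k, (n <= k)%N -> - a k <= eps.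
  by exists n => k /H; rewrite lerNl.
apply: (@relaxation_sign (- hi) (- lo) (fun i => - z i) (fun i => - a i) K) => //.
- by rewrite oppr_le0.
- by rewrite oppr_gt0.
- by move=> i; rewrite !lerN2 andbC.
- by move=> i; rewrite zS -clipN; [congr clip; ring|lra].
- by move=> i; rewrite -opprD normrN; have := hK i; congr (_ <= _); congr normr; ring.
- by move=> e' /hz[n H]; exists n => k /H; rewrite normrN.
Qed.

End Steps.

(** The upper limit of [Z] along the indices satisfying [Q], as the index grows and the tolerance
    shrinks together. Tying the tolerance of [Q] to [eps] allows such limits to be nested. *)
Lemma limsup_exists (Z : nat -> R) (B : R) (Q : R -> nat -> Prop) :
  (forall k, `|Z k| <= B) ->
  (forall e1 e2 k, e1 <= e2 -> Q e1 k -> Q e2 k) ->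
  (forall eps n, 0 < eps -> exists k, (n <= k)%N /\ Q eps k) ->
  exists s, (forall eps n, 0 < eps ->
               exists k, [/\ (n <= k)%N, Q eps k & s - eps <= Z k]) /\
            (forall eps, 0 < eps -> exists2 delta, 0 < delta & exists n,
               forall k, (n <= k)%N -> Q delta k -> Z k <= s + eps).
Proof.
move=> ZB Qmono Qfreq.
pose S := [set r : R | forall eps n, 0 < eps ->
  exists k, [/\ (n <= k)%N, Q eps k & r - eps <= Z k]]%classic.
have hS : has_sup S.
  split.
    exists (- B) => eps n e0; have [k [nk Qk]] := Qfreq _ n e0.
    exists k; split => //; have := ZB k; rewrite ler_norml; lra.
  exists (B + 1) => r /(_ 1 0%N ltr01)[k [_ _]].
  have := ZB k; rewrite ler_norml; lra.
exists (sup S); split.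
  move=> eps n e0; have e20 : 0 < eps / 2 by lra.
  have [r Sr hr] := sup_adherent e20 hS.
  have [k [nk Qk rk]] := Sr _ n e20; exists k; split => //; last lra.
  by apply: Qmono Qk; lra.
move=> eps e0; apply: contrapT => no.
have : S (sup S + eps) => [eps' n e'0|].
  apply: contrapT => no2; apply: no; exists eps' => //; exists n => k nk Qk.
  rewrite leNgt; apply/negP => h; apply: no2; exists k; split => //; lra.
by move=> /(ub_le_sup (proj2 hS)); lra.
Qed.

(** Bolzano-Weierstrass without subsequences: coordinates are added one at a time, the limit of a
    new one being its upper limit along the indices where [Q] holds and the earlier ones are already
    close. *)
Lemma bounded_cluster_point (I : finType) (x : nat -> I -> R) (B : R)
    (Q : R -> nat -> Prop) :
  (forall k i, `|x k i| <= B) ->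
  (forall e1 e2 k, e1 <= e2 -> Q e1 k -> Q e2 k) ->
  (forall eps n, 0 < eps -> exists k, (n <= k)%N /\ Q eps k) ->
  exists z : I -> R, forall eps n, 0 < eps ->
    exists k, [/\ (n <= k)%N, Q eps k & forall i, `|x k i - z i| <= eps].
Proof.
move=> xB Qmono Qfreq.
suff H (s : seq I) : exists z : I -> R, forall eps n, 0 < eps ->
    exists k, [/\ (n <= k)%N, Q eps k & forall i, i \in s -> `|x k i - z i| <= eps].
  have [z Hz] := H (enum I); exists z => eps n e0; have [k [nk Qk Hk]] := Hz eps n e0.
  by exists k; split => // i; apply: Hk; rewrite mem_enum.
elim: s => [|j s [z Hz]].
  by exists (fun=> 0) => eps n /(Qfreq _ n)[k [nk Qk]]; exists k.
have [|||r [H1 H2]] := @limsup_exists (fun k => x k j) B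
    (fun eps k => Q eps k /\ forall i, i \in s -> `|x k i - z i| <= eps).
- by move=> k; exact: xB.
- move=> e1 e2 k e12 [Qk hk]; split; first exact: Qmono Qk.
  by move=> i /hk h; exact: le_trans e12.
- by move=> eps n /(Hz _ n)[k [nk Qk hk]]; exists k.
exists (fun i => if i == j then r else z i) => eps n e0.
have [delta d0 [n' H]] := H2 _ e0.
pose e' := Num.min eps delta.
have e'0 : 0 < e' by rewrite lt_min e0.
have [e'e e'd] : e' <= eps /\ e' <= delta by rewrite /e' !ge_min !lexx ?orbT.
have [k [nk [Qk hk] rk]] := H1 e' (maxn n n') e'0.
move: nk; rewrite geq_max => /andP[nk n'k]; exists k; split => //.
  exact: Qmono Qk.
have ub := H k n'k (conj (Qmono _ _ _ e'd Qk) (fun i hi => le_trans (hk i hi) e'd)).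
move=> i; rewrite inE; case: (i =P j) => [-> _|_ /= /hk h]; last exact: le_trans e'e.
rewrite ler_norml; lra.
Qed.

End ScalarSequences.

(** * Polynomial functions of column vectors *)

Section Dotv.
Variables (R : realType) (n : nat).
Implicit Types x y z : 'cV[R]_n.

Lemma dotvC x y : dotv x y = dotv y x.
Proof. by apply: eq_bigr => i _; rewrite mulrC. Qed.

Lemma dotvDl x y z : dotv (x + y) z = dotv x z + dotv y z.
Proof. by rewrite -big_split /=; apply: eq_bigr => i _; rewrite mxE mulrDl. Qed.

Lemma dotvDr x y z : dotv z (x + y) = dotv z x + dotv z y.
Proof. by rewrite dotvC dotvDl !(dotvC z). Qed.

Lemma dotvNl x z : dotv (- x) z = - dotv x z.
Proof. by rewrite -sumrN; apply: eq_bigr => i _; rewrite mxE mulNr. Qed.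

Lemma dotvNr x z : dotv z (- x) = - dotv z x.
Proof. by rewrite dotvC dotvNl dotvC. Qed.

Lemma dotvE x y : dotv x y = (x^T *m y) 0 0.
Proof. by rewrite mxE; apply: eq_bigr => i _; rewrite mxE. Qed.

Lemma dotv_ge0 x : 0 <= dotv x x.
Proof. by apply: sumr_ge0 => i _; rewrite -expr2 sqr_ge0. Qed.

Lemma sqr_le_dotv x i : x i 0 ^+ 2 <= dotv x x.
Proof.
rewrite /dotv (bigD1 i) //= expr2 lerDl.
by apply: sumr_ge0 => j _; rewrite -expr2 sqr_ge0.
Qed.

End Dotv.

Section PolyFunctions.
Variables (R : realType) (n : nat).
Implicit Types F : 'cV[R]_n -> R.

(** Sampled drifts, gaps, squared distances and products of these with coordinates all have this
    form. Induction on it gives measurability along random iterates, and bounds and Lipschitz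
    constants on boxes. *)
Inductive polyf : ('cV[R]_n -> R) -> Prop :=
| polyf_cst a : polyf (fun=> a)
| polyf_coord i : polyf (fun x => x i 0)
| polyfD F1 F2 : polyf F1 -> polyf F2 -> polyf (fun x => F1 x + F2 x)
| polyfM F1 F2 : polyf F1 -> polyf F2 -> polyf (fun x => F1 x * F2 x).

Lemma polyf_ext F1 F2 : F1 =1 F2 -> polyf F1 -> polyf F2.
Proof. by move=> /funext ->. Qed.

Lemma polyfN F : polyf F -> polyf (fun x => - F x).
Proof.
move=> h; apply: (@polyf_ext (fun x => -1 * F x)) => [x|]; first by rewrite mulN1r.
exact: polyfM (polyf_cst _) h.
Qed.

Lemma polyfB F1 F2 : polyf F1 -> polyf F2 -> polyf (fun x => F1 x - F2 x).
Proof. by move=> h1 h2; apply: polyfD => //; exact: polyfN. Qed.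

Lemma polyf_sum (I : Type) (r : seq I) (P : pred I) (F : I -> 'cV[R]_n -> R) :
  (forall i, polyf (F i)) -> polyf (fun x => \sum_(i <- r | P i) F i x).
Proof.
move=> h; elim: r => [|i r IH].
  by apply: polyf_ext (polyf_cst 0) => x; rewrite big_nil.
case Pi: (P i).
  by apply: polyf_ext (polyfD (h i) IH) => k; rewrite big_cons Pi.
by apply: polyf_ext IH => k; rewrite big_cons Pi.
Qed.

Lemma polyf_sub_entry (y : 'cV[R]_n) j : polyf (fun x => (x - y) j 0).
Proof.
apply: (@polyf_ext (fun x => x j 0 - y j 0)) => [x|]; first by rewrite !mxE.
by apply: polyfB; [exact: polyf_coord|exact: polyf_cst].
Qed.

Lemma polyf_mulmx p q (A : 'M[R]_(p, q)) (Y : 'cV[R]_n -> 'cV[R]_q) i :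
  (forall j, polyf (fun x => Y x j 0)) -> polyf (fun x => (A *m Y x) i 0).
Proof.
move=> h; apply: (@polyf_ext (fun x => \sum_j A i j * Y x j 0)) => [x|].
  by rewrite mxE.
by apply: polyf_sum => j; apply: polyfM => //; exact: polyf_cst.
Qed.

Lemma polyf_dotv q (Y Z : 'cV[R]_n -> 'cV[R]_q) :
  (forall j, polyf (fun x => Y x j 0)) -> (forall j, polyf (fun x => Z x j 0)) ->
  polyf (fun x => dotv (Y x) (Z x)).
Proof. by move=> h1 h2; apply: polyf_sum => i; exact: polyfM. Qed.

Lemma polyf_measurable F d (T : measurableType d) (x : T -> 'cV[R]_n) :
  polyf F -> (forall c, measurable_fun setT (fun t => x t c 0)) ->
  measurable_fun setT (fun t => F (x t)).
Proof.
move=> hF hx; elim: hF => [a|i|F1 F2 _ h1 _ h2|F1 F2 _ h1 _ h2].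
- exact: measurable_cst.
- exact: hx.
- exact: measurable_funD.
- exact: measurable_funM.
Qed.

Lemma polyf_lipschitz F (lo hi : 'cV[R]_n) : polyf F ->
  exists2 L, 0 <= L & forall x y eps, box lo hi x -> box lo hi y ->
    (forall c, `|x c 0 - y c 0| <= eps) -> 0 <= eps -> `|F x - F y| <= L * eps.
Proof.
move=> hF.
(* The bound [B] is carried through the induction because the Lipschitz constant of a product
   involves bounds of the factors. *)
suff [L [B [L0 B0 H _]]] : exists L B, [/\ 0 <= L, 0 <= B,
    (forall x y eps, box lo hi x -> box lo hi y ->
    (forall c, `|x c 0 - y c 0| <= eps) -> 0 <= eps -> `|F x - F y| <= L * eps) &
    forall x, box lo hi x -> `|F x| <= B] by exists L.
elim: hF => [a|i|F1 F2 _ [L1 [B1 [L10 B10 H1 b1]]] _ [L2 [B2 [L20 B20 H2 b2]]]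
            |F1 F2 _ [L1 [B1 [L10 B10 H1 b1]]] _ [L2 [B2 [L20 B20 H2 b2]]]].
- exists 0, `|a|; split => // x y eps _ _ _ _; by rewrite subrr normr0 mul0r.
- have b0 : 0 <= `|lo i 0| + `|hi i 0| by rewrite addr_ge0.
  exists 1, (`|lo i 0| + `|hi i 0|); split => //.
    by move=> x y eps _ _ h _; rewrite mul1r.
  move=> x /(_ i); rewrite ler_norml.
  have := ler_norm (hi i 0); have := ler_norm (- lo i 0); rewrite normrN.
  have := normr_ge0 (hi i 0); have := normr_ge0 (lo i 0); lra.
- exists (L1 + L2), (B1 + B2); split; try lra.
    move=> x y eps hx hy h e0; rewrite mulrDl.
    have -> : F1 x + F2 x - (F1 y + F2 y) = (F1 x - F1 y) + (F2 x - F2 y) by ring.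
    apply: le_trans (ler_normD _ _) _; apply: lerD; [exact: H1|exact: H2].
  move=> x hx; apply: le_trans (ler_normD _ _) _; apply: lerD; [exact: b1|exact: b2].
- exists (L1 * B2 + B1 * L2), (B1 * B2); split; rewrite ?mulr_ge0 ?addr_ge0 ?mulr_ge0 //.
    move=> x y eps hx hy h e0; rewrite mulrDl.
    have -> : F1 x * F2 x - F1 y * F2 y = (F1 x - F1 y) * F2 x + F1 y * (F2 x - F2 y).
      by ring.
    apply: le_trans (ler_normD _ _) _; rewrite !normrM.
    have -> : L1 * B2 * eps = L1 * eps * B2 by ring.
    rewrite -(mulrA B1); apply: lerD; apply: ler_pM => //.
    - exact: H1.
    - exact: b2.
    - exact: b1.
    - exact: H2.
  by move=> x hx; rewrite normrM; apply: ler_pM => //; [exact: b1|exact: b2].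
Qed.

Lemma polyf_bounded F (lo hi : 'cV[R]_n) : polyf F ->
  exists2 B, 0 <= B & forall x, box lo hi x -> `|F x| <= B.
Proof.
move=> hF; have [[x0 hx0]|h] := pselect (exists x, box lo hi x); last first.
  by exists 0 => // x hx; case: h; exists x.
have [L L0 H] := polyf_lipschitz lo hi hF.
pose e := \sum_c (hi c 0 - lo c 0).
have le_e c : 0 <= hi c 0 - lo c 0 <= e.
  have h i : 0 <= hi i 0 - lo i 0 by have := hx0 i; lra.
  by rewrite h /e (bigD1 c) //= lerDl sumr_ge0.
have e0 : 0 <= e by apply: sumr_ge0 => i _; have := le_e i; lra.
exists (`|F x0| + L * e); first by rewrite addr_ge0 ?mulr_ge0.
move=> x hx; rewrite -[F x](subrK (F x0)) addrC; apply: le_trans (ler_normD _ _) _.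
rewrite lerD2l; apply: H => // c; rewrite ler_norml.
have := hx c; have := hx0 c; have := le_e c; lra.
Qed.

End PolyFunctions.

(** * Projected monotone iterations *)

Lemma sqr_le_norm (R : realType) (a b : R) : `|a| <= `|b| -> a ^+ 2 <= b ^+ 2.
Proof.
move=> h; rewrite -(real_normK (num_real a)) -(real_normK (num_real b)).
by rewrite ler_pXn2r ?nnegrE.
Qed.

Section Fejer.
Variables (R : realType) (n : nat) (A : 'M[R]_n) (lo hi xs : 'cV[R]_n).
Variables (alpha : nat -> R) (x eta : nat -> 'cV[R]_n) (B : R).

Implicit Types y u : 'cV[R]_n.

Hypothesis A_monotone : forall y, 0 <= dotv (A *m y) y.
Hypothesis xs_box : box lo hi xs.
Hypothesis x_box : forall k, box lo hi (x k).
Hypothesis alpha_gt0 : forall k, 0 < alpha k.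
Hypothesis alpha_div : forall k (T : R), exists m, T <= \sum_(k <= i < m) alpha i.
Hypothesis alpha_sq : csum (fun k => alpha k ^+ 2).
Hypothesis xS : forall k c, x k.+1 c 0 = clip (lo c 0) (hi c 0)
  (x k c 0 - alpha k * (A *m (x k - xs)) c 0 - eta k c 0).
Hypothesis B_ge0 : 0 <= B.
Hypothesis incr_bound : forall k c,
  `|alpha k * (A *m (x k - xs)) c 0 + eta k c 0| <= B * alpha k.
Hypothesis eta_csum : forall c, csum (fun k => eta k c 0).
Hypothesis eta_x_csum : csum (fun k => dotv (eta k) (x k)).

Local Notation elapsed k m := (\sum_(k <= i < m) alpha i).
(** [u] solves the variational inequality when [gap u y] is nonpositive for all [y] in the box,
    while [gap u xs] is the quadratic form of [A], hence nonnegative. *)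
Local Notation gap u y := (dotv (A *m (u - xs)) (u - y)).
Local Notation sqd u y := (dotv (u - y) (u - y)).

Lemma polyf_gap y : polyf (fun u => gap u y).
Proof.
by apply: polyf_dotv => j; [apply: polyf_mulmx => k|]; exact: polyf_sub_entry.
Qed.

Lemma polyf_sqd y : polyf (fun u => sqd u y).
Proof. by apply: polyf_dotv => j; exact: polyf_sub_entry.
Qed.

Lemma iterate_slow k c : `|x k.+1 c 0 - x k c 0| <= B * alpha k.
Proof.
rewrite xS; apply: le_trans (clip_dist _ (x_box k c)) _.
set g := (A *m _) c 0.
have -> : x k c 0 - alpha k * g - eta k c 0 - x k c 0 =
  - (alpha k * g + eta k c 0) by ring.
by rewrite normrN; exact: incr_bound.
Qed.

Lemma polyf_slow F : polyf F ->
  exists2 K, 0 <= K & forall k, `|F (x k.+1) - F (x k)| <= K * alpha k.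
Proof.
move=> /(polyf_lipschitz lo hi)[L L0 H]; exists (L * B); first exact: mulr_ge0.
move=> k; rewrite -mulrA; apply: H => //; first exact: iterate_slow.
by rewrite mulr_ge0 // ltW.
Qed.

(** In each coordinate, clipping does not increase the distance to [y]. Once the square is expanded,
    drift and noise enter linearly, and the square of the total increment is at most
    [B ^+ 2 * alpha k ^+ 2] in each of the [n] coordinates. *)
Lemma fejer_step y k : box lo hi y ->
  sqd (x k.+1) y <= sqd (x k) y - 2 * (alpha k * gap (x k) y)
    - 2 * dotv (eta k) (x k - y) + n%:R * B ^+ 2 * alpha k ^+ 2.
Proof.
move=> hy; set g := A *m (x k - xs).
have -> : n%:R * B ^+ 2 * alpha k ^+ 2 = \sum_(c < n) (B * alpha k) ^+ 2.
  by rewrite sumr_const card_ord -[RHS]mulr_natl exprMn; ring.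
rewrite /dotv !mulr_sumr -!sumrB -big_split /=; apply: ler_sum => c _.
have subE (u : 'cV[R]_n) : (u - y) c 0 = u c 0 - y c 0 by rewrite !mxE.
rewrite -/g !subE xS -/g; set e := alpha k * g c 0 + eta k c 0.
have -> : x k c 0 - alpha k * g c 0 - eta k c 0 = x k c 0 - e by rewrite /e; ring.
set z := clip _ _ _.
have h1 : (z - y c 0) ^+ 2 <= (x k c 0 - e - y c 0) ^+ 2.
  by apply: sqr_le_norm; apply: clip_dist; exact: hy.
have h2 : e ^+ 2 <= (B * alpha k) ^+ 2.
  apply: sqr_le_norm; rewrite [X in _ <= X]ger0_norm; first exact: incr_bound.
  by rewrite mulr_ge0 // ltW.
rewrite -!expr2; move: h1 h2; rewrite /e; lra.
Qed.

Lemma fejer_window y k m : box lo hi y -> (k <= m)%N ->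
  sqd (x m) y <= sqd (x k) y - 2 * \sum_(k <= i < m) alpha i * gap (x i) y
    - 2 * \sum_(k <= i < m) dotv (eta i) (x i - y)
    + n%:R * B ^+ 2 * \sum_(k <= i < m) alpha i ^+ 2.
Proof.
move=> hy; elim: m => [|m IH].
  by rewrite leqn0 => /eqP ->; rewrite !big_geq // !mulr0 !subr0 addr0.
rewrite leq_eqVlt => /orP[/eqP <-|]; first by rewrite !big_geq // !mulr0 !subr0 addr0.
rewrite ltnS => km; rewrite !big_nat_recr //=.
have := fejer_step m hy; have := IH km; lra.
Qed.

(** Linearity in [y] gives this for all [y] from two fixed assumptions on the noise; later [y] is a
    point that depends on the trajectory. *)
Lemma noise_csum y : csum (fun k => dotv (eta k) (x k - y)).
Proof.
have h := csum_sum (index_enum 'I_n) predT (fun c => csumZ (y c 0) (eta_csum c)).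
apply: eq_csum (csumD eta_x_csum (csumZ (-1) h)) => k.
rewrite dotvDr dotvNr mulN1r; congr (_ - _).
by rewrite dotvC; apply: eq_bigr => c _.
Qed.

Lemma window_error y eps : 0 < eps -> exists N, forall k m,
  (N <= k)%N -> (k <= m)%N ->
  - 2 * \sum_(k <= i < m) dotv (eta i) (x i - y)
    + n%:R * B ^+ 2 * \sum_(k <= i < m) alpha i ^+ 2 <= eps.
Proof.
move=> e0; have h := csumD (csumZ (-2) (noise_csum y)) (csumZ (n%:R * B ^+ 2) alpha_sq).
have [N H] := h _ e0; exists N => k m Nk km.
rewrite !mulr_sumr -big_split /=; exact: le_trans (ler_norm _) (H k m Nk km).
Qed.

Lemma sqd_bounded y : exists2 D, 0 <= D & forall k, sqd (x k) y <= D.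
Proof.
have [D D0 H] := polyf_bounded lo hi (polyf_sqd y).
by exists D => // k; exact: le_trans (ler_norm _) (H _ (x_box k)).
Qed.

(** Telescoping the squared distance to [xs] bounds the weighted series of the gaps. A weighted
    series alone would only give a lower limit [0]; slow variation turns it into a limit. *)
Lemma gap_tends0 : tends0 (fun k => gap (x k) xs).
Proof.
have [D D0 HD] := sqd_bounded xs.
have [K _ HK] := polyf_slow (polyf_gap xs).
have [N HN] := window_error xs (@ltr01 R).
apply: (slow_summable_tends0 alpha_gt0 alpha_div _ HK).
  by move=> k; exact: A_monotone.
pose s := \sum_(0 <= i < N) alpha i * gap (x i) xs.
have ge0 i : 0 <= alpha i * gap (x i) xs by rewrite mulr_ge0 ?A_monotone // ltW.
apply: (@csum_bounded _ _ (s + (D + 1) / 2)) => // m.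
have [mN|Nm] := leqP m N.
  rewrite /s (big_cat_nat (n := m) (p := N)) //=.
  have : 0 <= \sum_(m <= i < N) alpha i * gap (x i) xs by exact: sumr_ge0.
  lra.
rewrite (big_cat_nat (n := N)) ?(ltnW Nm) //= -/s lerD2l.
have := fejer_window xs_box (ltnW Nm); have := HN N m (leqnn _) (ltnW Nm).
have := dotv_ge0 (x m - xs); have := HD N; lra.
Qed.

Section Limit.
Variable z : 'cV[R]_n.

Lemma near_box : (forall eps, 0 < eps -> exists k, forall c,
  `|x k c 0 - z c 0| <= eps) -> box lo hi z.
Proof.
move=> h c; apply/andP; split; apply/ler_addgt0Pr => eps /h[k /(_ c)];
  have := x_box k c; rewrite ler_norml; lra.
Qed.

(** If the gap [kappa] at [z] were positive, it would stay above [kappa / 2] throughout the window,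
    and the squared distance to [y] would drop by [kappa * T = D + 2]. That is impossible, as it
    starts at most at [D] and the errors add at most [1]. *)
Lemma window_variational_ineq y :
  (forall eps T N, 0 < eps -> exists2 k, (N <= k)%N & forall j, (k <= j)%N ->
     elapsed k j < T -> forall c, `|x j c 0 - z c 0| <= eps) ->
  box lo hi y -> gap z y <= 0.
Proof.
move=> hz hy; rewrite leNgt; apply/negP; set kappa := gap z y => kappa0.
have zbox : box lo hi z.
  apply: near_box => eps e0; have [k _ /(_ k (leqnn _))] := hz _ 1 0%N e0.
  by rewrite big_geq // => /(_ ltr01); exists k.
have [L L0 HL] := polyf_lipschitz lo hi (polyf_gap y).
have [D D0 HD] := sqd_bounded y.
have [N HN] := window_error y (@ltr01 R).
have L1 : 0 < 2 * (L + 1) by lra.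
pose T := (D + 2) / kappa; have T0 : 0 < T by rewrite divr_gt0 //; lra.
have eps0 : 0 < kappa / (2 * (L + 1)) by rewrite divr_gt0.
have [k Nk Hk] := hz _ T N eps0.
have [m [km Tm mT]] := elapsed_exit alpha_div k T0.
have : kappa / 2 * elapsed k m <= \sum_(k <= i < m) alpha i * gap (x i) y.
  rewrite mulr_sumr big_nat_cond [X in _ <= X]big_nat_cond; apply: ler_sum => i.
  rewrite andbT => kim; rewrite mulrC; apply: ler_wpM2l; first exact: ltW.
  have h := Hk i (proj1 (andP kim)) (mT i kim).
  have := HL _ _ _ (x_box i) zbox h (ltW eps0); rewrite -/kappa ler_norml.
  have : L * (kappa / (2 * (L + 1))) <= kappa / 2.
    have -> : L * (kappa / (2 * (L + 1))) = L * kappa / (2 * (L + 1)) by ring.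
    rewrite ler_pdivrMr //.
    have -> : kappa / 2 * (2 * (L + 1)) = L * kappa + kappa by field.
    lra.
  lra.
have : kappa / 2 * T <= kappa / 2 * elapsed k m by rewrite ler_wpM2l //; lra.
have -> : kappa / 2 * T = (D + 2) / 2 by rewrite /T; field; lra.
have := fejer_window hy (ltnW km); have := HN k m Nk (ltnW km).
have := dotv_ge0 (x m - y); have := HD k; lra.
Qed.

(** Since [z] solves the variational inequality, monotonicity makes [gap (x k) z] nonnegative: the
    drift never pushes away from [z]. An iterate that comes close late enough, when the remaining
    errors are small, is followed by iterates that all stay close. *)
Lemma cluster_solution_limit :
  (forall eps N, 0 < eps -> exists2 k, (N <= k)%N & forall c,
     `|x k c 0 - z c 0| <= eps) ->
  (forall y, box lo hi y -> gap z y <= 0) ->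
  tends0 (fun k => sqd (x k) z).
Proof.
move=> hz VI.
have zbox : box lo hi z by apply: near_box => eps e0; have [k _ h] := hz _ 0%N e0; exists k.
have gap_ge0 k : 0 <= alpha k * gap (x k) z.
  apply: mulr_ge0; first exact: ltW.
  have := VI _ (x_box k); have := A_monotone (x k - z).
  have -> : gap (x k) z = dotv (A *m (x k - z)) (x k - z) - gap z (x k).
    rewrite -dotvNr opprB -dotvDl -mulmxDr; congr (dotv (_ *m _) _).
    by rewrite addrA subrK.
  lra.
move=> eps e0; have [L L0 HL] := polyf_lipschitz lo hi (polyf_sqd z).
have e20 : 0 < eps / 2 by lra.
have [N HN] := window_error z e20.
have L1 : 0 < 2 * (L + 1) by lra.
have eps0 : 0 < eps / (2 * (L + 1)) by rewrite divr_gt0.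
have [k Nk hk] := hz _ N eps0; exists k => m km.
rewrite ger0_norm ?dotv_ge0 //.
have := HL _ _ _ (x_box k) zbox hk (ltW eps0); rewrite ler_norml.
have : L * (eps / (2 * (L + 1))) <= eps / 2.
  have -> : L * (eps / (2 * (L + 1))) = L * eps / (2 * (L + 1)) by ring.
  rewrite ler_pdivrMr //.
  have -> : eps / 2 * (2 * (L + 1)) = L * eps + eps by field.
  lra.
have -> : sqd z z = 0 by rewrite subrr /dotv big1 // => c _; rewrite mxE mul0r.
have := fejer_window zbox km; have := HN k m Nk km.
have : 0 <= \sum_(k <= i < m) alpha i * gap (x i) z by apply: sumr_ge0.
lra.
Qed.

End Limit.
End Fejer.

(** * The saddle-point structure *)

Lemma eventually_fin (I : finType) (P : I -> nat -> Prop) :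
  (forall i, exists N, forall k, (N <= k)%N -> P i k) ->
  exists N, forall k, (N <= k)%N -> forall i, P i k.
Proof.
move=> /choice[f hf]; exists (\max_i f i) => k hk i; apply: hf.
exact: leq_trans (leq_bigmax i) hk.
Qed.

Section Tends0.
Variable R : realType.
Implicit Types u : nat -> R.

Lemma tends0_sum (I : Type) (r : seq I) (P : pred I) (u : I -> nat -> R) :
  (forall i, tends0 (u i)) -> tends0 (fun k => \sum_(i <- r | P i) u i k).
Proof.
move=> h; elim: r => [|i r IH] eps e0.
  by exists 0%N => k _; rewrite big_nil normr0 ltW.
have e20 : 0 < eps / 2 by lra.
have [N1 H1] := h i _ e20; have [N2 H2] := IH _ e20.
exists (maxn N1 N2) => k; rewrite geq_max big_cons => /andP[/H1 k1 /H2 k2].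
by case: ifP => _; [apply: le_trans (ler_normD _ _) _|]; lra.
Qed.

Lemma tends0Z (a : R) u : tends0 u -> tends0 (fun k => a * u k).
Proof.
move=> h eps e0; have a0 : 0 < `|a| + 1 by have := normr_ge0 a; lra.
have [N H] := h _ (divr_gt0 e0 a0); exists N => k /H.
rewrite normrM ler_pdivlMr // => h1; apply: le_trans h1.
by rewrite mulrC ler_wpM2l //; lra.
Qed.

Lemma tends0_mulmx p q (K : 'M[R]_(p, q)) (Y : nat -> 'cV[R]_q) c :
  (forall j, tends0 (fun k => Y k j 0)) -> tends0 (fun k => (K *m Y k) c 0).
Proof.
move=> h eps e0.
have [N H] := tends0_sum (index_enum 'I_q) predT (fun j => tends0Z (K c j) (h j)) e0.
by exists N => k /H; rewrite mxE.
Qed.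

Lemma tends0_sqr_le u1 u2 (C : R) :
  (forall k, u1 k ^+ 2 <= C * u2 k) -> tends0 u2 -> tends0 u1.
Proof.
move=> h /(tends0Z C) h2 eps e0; have e2 : 0 < eps ^+ 2 by rewrite exprn_gt0.
have [N H] := h2 _ e2; exists N => k /H h3.
have : `|u1 k| ^+ 2 <= eps ^+ 2.
  rewrite real_normK ?num_real //; apply: le_trans (h k) _.
  exact: le_trans (ler_norm _) h3.
by rewrite ler_pXn2r ?nnegrE // ltW.
Qed.

Lemma mulmx_small p q (K : 'M[R]_(p, q)) : exists2 C, 0 <= C &
  forall (y : 'cV[R]_q) e, (forall j, `|y j 0| <= e) -> forall c, `|(K *m y) c 0| <= C * e.
Proof.
exists (\sum_c \sum_j `|K c j|); first by do 2 apply: sumr_ge0 => ? _.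
move=> y e h c; rewrite (bigD1 c) //= mulrDl.
apply: (@le_trans _ _ ((\sum_j `|K c j|) * e)).
  rewrite mxE mulr_suml; apply: le_trans (ler_norm_sum _ _ _) _.
  by apply: ler_sum => j _; rewrite normrM ler_wpM2l.
(* When [q = 0] nothing forces [e] to be nonnegative, but all sums over columns vanish. *)
have [j0|no] := pselect (exists j : 'I_q, True); last first.
  have z f : \sum_(j < q) f j = 0 :> R by apply: big1 => j; case: no; exists j.
  by rewrite [X in _ + X * e]big1 ?mul0r ?addr0 // => i _; rewrite z.
have e0 : 0 <= e by case: j0 => j _; exact: le_trans (h j).
by rewrite lerDl mulr_ge0 //; apply: sumr_ge0 => i _; apply: sumr_ge0.
Qed.

(** This is how an extremal choice freezes coordinates: if no summand can go down much and the sum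
    cannot go up much, then no single summand can go up much. *)
Lemma summand_ub m (d : 'I_m -> R) (e E : R) : 0 <= e -> (forall c, - e <= d c) ->
  \sum_c d c <= E -> forall c, d c <= E + m%:R * e.
Proof.
move=> e0 hd hE c.
have : d c + e <= \sum_(c' < m) (d c' + e).
  rewrite (bigD1 c) //= lerDl; apply: sumr_ge0 => i _; have := hd i; lra.
rewrite big_split /= sumr_const card_ord -mulr_natl; lra.
Qed.

End Tends0.

Section Col4.
Variables (R : realType) (m : nat).

Definition idx_th (c : 'I_m) : 'I_(dim4 m) := lshift _ c.
Definition idx_v (c : 'I_m) : 'I_(dim4 m) := rshift m (lshift _ c).
Definition idx_mu (c : 'I_m) : 'I_(dim4 m) := rshift m (rshift m (lshift _ c)).
Definition idx_w (c : 'I_m) : 'I_(dim4 m) := rshift m (rshift m (rshift m c)).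

Lemma idx4P (P : 'I_(dim4 m) -> Prop) :
  (forall c, P (idx_th c)) -> (forall c, P (idx_v c)) ->
  (forall c, P (idx_mu c)) -> (forall c, P (idx_w c)) -> forall c, P c.
Proof.
move=> h1 h2 h3 h4 c; case: (split_ordP c) => [d ->|d ->]; first exact: h1.
case: (split_ordP d) => [f ->|f ->]; first exact: h2.
by case: (split_ordP f) => [g ->|g ->]; [exact: h3|exact: h4].
Qed.

Lemma theta_ofE (x : 'cV[R]_(dim4 m)) c : theta_of x c 0 = x (idx_th c) 0.
Proof. by rewrite mxE. Qed.
Lemma v_ofE (x : 'cV[R]_(dim4 m)) c : v_of x c 0 = x (idx_v c) 0.
Proof. by rewrite !mxE. Qed.
Lemma mu_ofE (x : 'cV[R]_(dim4 m)) c : mu_of x c 0 = x (idx_mu c) 0.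
Proof. by rewrite !mxE. Qed.
Lemma w_ofE (x : 'cV[R]_(dim4 m)) c : w_of x c 0 = x (idx_w c) 0.
Proof. by rewrite !mxE. Qed.

Lemma theta_of_col4 (a b c d : 'cV[R]_m) : theta_of (col4 a b c d) = a.
Proof. by rewrite /theta_of /col4 col_mxKu. Qed.
Lemma v_of_col4 (a b c d : 'cV[R]_m) : v_of (col4 a b c d) = b.
Proof. by rewrite /v_of /col4 col_mxKd col_mxKu. Qed.
Lemma mu_of_col4 (a b c d : 'cV[R]_m) : mu_of (col4 a b c d) = c.
Proof. by rewrite /mu_of /col4 !col_mxKd col_mxKu. Qed.
Lemma w_of_col4 (a b c d : 'cV[R]_m) : w_of (col4 a b c d) = d.
Proof. by rewrite /w_of /col4 !col_mxKd. Qed.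

Definition of_col4 := (theta_of_col4, v_of_col4, mu_of_col4, w_of_col4).

Lemma col4_of (x : 'cV[R]_(dim4 m)) :
  x = col4 (theta_of x) (v_of x) (mu_of x) (w_of x).
Proof. by rewrite /col4 !vsubmxK. Qed.

Lemma col4_idx_th (a b c d : 'cV[R]_m) i : col4 a b c d (idx_th i) 0 = a i 0.
Proof. by rewrite -theta_ofE of_col4. Qed.
Lemma col4_idx_v (a b c d : 'cV[R]_m) i : col4 a b c d (idx_v i) 0 = b i 0.
Proof. by rewrite -v_ofE of_col4. Qed.
Lemma col4_idx_mu (a b c d : 'cV[R]_m) i : col4 a b c d (idx_mu i) 0 = c i 0.
Proof. by rewrite -mu_ofE of_col4. Qed.
Lemma col4_idx_w (a b c d : 'cV[R]_m) i : col4 a b c d (idx_w i) 0 = d i 0.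
Proof. by rewrite -w_ofE of_col4. Qed.

Definition col4_idx := (col4_idx_th, col4_idx_v, col4_idx_mu, col4_idx_w).

Lemma dotv_col4 (a b c d a' b' c' d' : 'cV[R]_m) :
  dotv (col4 a b c d) (col4 a' b' c' d') =
  dotv a a' + dotv b b' + dotv c c' + dotv d d'.
Proof.
rewrite /dotv !big_split_ord /= -!addrA; do ! congr (_ + _);
  by apply: eq_bigr => i _; rewrite ?(col4_idx_th, col4_idx_v, col4_idx_mu, col4_idx_w).
Qed.

Lemma mul_col4 (M1 M2 M3 M4 : 'M[R]_(m, dim4 m)) (y : 'cV[R]_(dim4 m)) :
  col4 M1 M2 M3 M4 *m y = col4 (M1 *m y) (M2 *m y) (M3 *m y) (M4 *m y).
Proof. by rewrite /col4 !mul_col_mx. Qed.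

Lemma mul_row4 (M1 M2 M3 M4 : 'M[R]_m) (y : 'cV[R]_(dim4 m)) :
  row4 M1 M2 M3 M4 *m y =
  M1 *m theta_of y + M2 *m v_of y + M3 *m mu_of y + M4 *m w_of y.
Proof.
by rewrite {1}(col4_of y) /row4 /col4 !mul_row_col !addrA.
Qed.

End Col4.

Section SaddleMatrix.
Variables (R : realType) (m : nat) (G M L : 'M[R]_m).

Definition saddle_mx : 'M[R]_(dim4 m) :=
  col4 (row4 G 0 0 M) (row4 0 1%:M 0 (- L)) (row4 0 0 0 (- L)) (row4 (- M^T) L L 0).

Lemma saddle_mulE (y : 'cV[R]_(dim4 m)) : saddle_mx *m y =
  col4 (G *m theta_of y + M *m w_of y) (v_of y - L *m w_of y) (- (L *m w_of y))
       (- (M^T *m theta_of y) + L *m v_of y + L *m mu_of y).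
Proof.
rewrite mul_col4 !mul_row4; congr col4;
  by rewrite ?mul0mx ?mul1mx ?mulNmx ?add0r ?addr0.
Qed.

Lemma dotv_mulmx (K : 'M[R]_m) (y z : 'cV[R]_m) : dotv (K *m y) z = dotv y (K^T *m z).
Proof. by rewrite !dotvE trmx_mul mulmxA. Qed.

Lemma saddle_quad (y : 'cV[R]_(dim4 m)) : L^T = L ->
  dotv (saddle_mx *m y) y =
  dotv (G *m theta_of y) (theta_of y) + dotv (v_of y) (v_of y).
Proof.
move=> Lsym; rewrite saddle_mulE [X in dotv _ X](col4_of y) dotv_col4 !dotvDl !dotvNl.
rewrite (dotv_mulmx M) (dotvC (w_of y)) (dotv_mulmx L (w_of y) (v_of y)).
rewrite (dotv_mulmx L (w_of y) (mu_of y)) Lsym !(dotvC (w_of y)); lra.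
Qed.

End SaddleMatrix.

(** * Convergence of a trajectory *)

(** Where [u c] is nonzero, the sign-weighted move is bounded below, and its upper bound comes from
    the sum. Where [u c = 0] the sum says nothing, but both one-sided bounds apply; hence the
    maximum. *)
Lemma signed_moves_small (R : realType) m (u d : 'I_m -> R) (e E : R) : 0 <= e ->
  (forall c, 0 <= u c -> - e <= d c) -> (forall c, u c <= 0 -> d c <= e) ->
  \sum_c Num.sg (u c) * d c <= E ->
  forall c, `|d c| <= Num.max e (E + m%:R * e).
Proof.
move=> e0 lb ub hE c.
have low i : - e <= Num.sg (u i) * d i.
  have [ui|ui|ui] := ltrgt0P (u i).
  - by rewrite gtr0_sg // mul1r; apply: lb; exact: ltW.
  - by rewrite ltr0_sg // mulN1r lerN2; apply: ub; exact: ltW.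
  - by rewrite ui sgr0 mul0r; lra.
have := summand_ub e0 low hE c; have := low c; rewrite le_max.
have [uc|uc|uc] := ltrgt0P (u c).
- rewrite gtr0_sg // mul1r => h1 h2; have [dc|dc] := leP 0 (d c).
    by rewrite ger0_norm // h2 orbT.
  by rewrite ltr0_norm // lerNl h1.
- rewrite ltr0_sg // mulN1r => h1 h2; have [dc|dc] := leP 0 (d c).
    by rewrite ger0_norm // -lerN2 h1.
  by rewrite ltr0_norm // h2 orbT.
- by move=> _ _; rewrite ler_norml lb ?uc // ub ?uc.
Qed.

Section SaddleConvergence.
Variables (R : realType) (m : nat) (G M L : 'M[R]_m) (C : R).
Let n := dim4 m.
Let A : 'M[R]_n := saddle_mx G M L.
Variables (lo hi xs : 'cV[R]_n).
Variables (alpha : nat -> R) (x eta : nat -> 'cV[R]_n) (B : R).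

Hypothesis L_sym : L^T = L.
Hypothesis G_ge0 : forall y : 'cV[R]_m, 0 <= dotv (G *m y) y.
Hypothesis G_coercive : forall (y : 'cV[R]_m) c, y c 0 ^+ 2 <= C * dotv (G *m y) y.
Hypothesis xs_box : box lo hi xs.
Hypothesis xs_v : v_of xs = 0.
Hypothesis box_v_nondeg : forall c, lo (idx_v c) 0 < hi (idx_v c) 0.
Hypothesis x_box : forall k, box lo hi (x k).
Hypothesis alpha_gt0 : forall k, 0 < alpha k.
Hypothesis alpha_div : forall k (T : R), exists m, T <= \sum_(k <= i < m) alpha i.
Hypothesis alpha_sq : csum (fun k => alpha k ^+ 2).
Hypothesis xS : forall k c, x k.+1 c 0 = clip (lo c 0) (hi c 0)
  (x k c 0 - alpha k * (A *m (x k - xs)) c 0 - eta k c 0).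
Hypothesis B_ge0 : 0 <= B.
Hypothesis incr_bound : forall k c,
  `|alpha k * (A *m (x k - xs)) c 0 + eta k c 0| <= B * alpha k.
Hypothesis eta_csum : forall c, csum (fun k => eta k c 0).
Hypothesis eta_x_csum : csum (fun k => dotv (eta k) (x k)).
Hypothesis eta_v : forall k c, eta k (idx_v c) 0 = 0.
Hypothesis eta_mu : forall k c, eta k (idx_mu c) 0 = 0.

Local Notation elapsed k m := (\sum_(k <= i < m) alpha i).
Local Notation mu k c := (x k (idx_mu c) 0).
Local Notation w k c := (x k (idx_w c) 0).
Local Notation y k := (x k - xs).

Lemma saddle_monotone u : 0 <= dotv (A *m u) u.
Proof. by rewrite saddle_quad // addr_ge0 // dotv_ge0. Qed.

Let quad_tends0 : tends0 (fun k => dotv (A *m (x k - xs)) (x k - xs)) :=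
  gap_tends0 saddle_monotone xs_box x_box alpha_gt0 alpha_div alpha_sq xS B_ge0
    incr_bound eta_csum eta_x_csum.

Lemma v_tends0 c : tends0 (fun k => x k (idx_v c) 0).
Proof.
apply: (tends0_sqr_le (C := 1)) quad_tends0 => k; rewrite mul1r saddle_quad //.
have -> : x k (idx_v c) 0 = v_of (y k) c 0.
  by rewrite v_ofE !mxE -(v_ofE xs) xs_v mxE subr0.
by apply: le_trans (sqr_le_dotv _ c) _; rewrite lerDr.
Qed.

Lemma theta_tends0 c : tends0 (fun k => theta_of (y k) c 0).
Proof.
have h : tends0 (fun k => dotv (G *m theta_of (y k)) (theta_of (y k))).
  move=> eps /quad_tends0[N H]; exists N => k /H.
  rewrite saddle_quad // !ger0_norm ?addr_ge0 ?dotv_ge0 //.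
  by have := dotv_ge0 (v_of (y k)); lra.
by apply: tends0_sqr_le h => k; exact: G_coercive.
Qed.

(** For DGTD the reference [w] is the same vector for all agents and is killed by the Laplacian, so
    this is just [L w]. *)
Local Notation disagreement k c := ((L *m w_of (y k)) c 0).

Lemma v_step k c : x k.+1 (idx_v c) 0 = clip (lo (idx_v c) 0) (hi (idx_v c) 0)
  (x k (idx_v c) 0 + alpha k * (disagreement k c - x k (idx_v c) 0)).
Proof.
rewrite xS eta_v saddle_mulE col4_idx; congr clip.
have -> : (v_of (y k) - L *m w_of (y k)) c 0 = x k (idx_v c) 0 - disagreement k c.
  rewrite !mxE; congr (_ - _); have := congr1 (fun u : 'cV_m => u c 0) xs_v.
  by rewrite !mxE => ->; rewrite subr0.
ring.
Qed.

Lemma mu_step k c : mu k.+1 c = clip (lo (idx_mu c) 0) (hi (idx_mu c) 0)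
  (mu k c + alpha k * disagreement k c - 0).
Proof.
rewrite xS eta_mu saddle_mulE col4_idx mxE; congr clip; ring.
Qed.

Lemma w_step k c : w k.+1 c = clip (lo (idx_w c) 0) (hi (idx_w c) 0)
  (w k c + alpha k * - ((A *m y k) (idx_w c) 0) - eta k (idx_w c) 0).
Proof. by rewrite xS mulrN. Qed.

Lemma box_le c : lo c 0 <= hi c 0.
Proof. by have := xs_box c; lra. Qed.

(** The interval of [v] contains [0] and has room on at least one side of it. The sign [s c] points
    to such a side: a disagreement persisting in that direction would drive [v] away from [0]. *)
Lemma disagreement_sign : exists s : 'I_m -> R, forall c, (s c = 1 \/ s c = -1) /\
  forall eps, 0 < eps -> exists N, forall k, (N <= k)%N -> s c * disagreement k c <= eps.
Proof.
suff h c : exists sc : R, (sc = 1 \/ sc = -1) /\ forall eps, 0 < eps ->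
    exists N, forall k, (N <= k)%N -> sc * disagreement k c <= eps.
  by have [s hs] := choice h; exists s.
have pf : polyf (fun u => (L *m w_of (u - xs)) c 0).
  apply: polyf_mulmx => j; apply: (@polyf_ext _ _ (fun u => u (idx_w j) 0 - xs (idx_w j) 0)).
    by move=> u; rewrite w_ofE !mxE.
  by apply: polyfB; [exact: polyf_coord|exact: polyf_cst].
have [K _ HK] := polyf_slow x_box alpha_gt0 xS B_ge0 incr_bound pf.
have vbox k : lo (idx_v c) 0 <= x k (idx_v c) 0 <= hi (idx_v c) 0 by exact: x_box.
have : lo (idx_v c) 0 <= 0 <= hi (idx_v c) 0.
  by have := xs_box (idx_v c); rewrite -(v_ofE xs) xs_v mxE.
move=> /andP[lo0 hi0]; have nondeg := box_v_nondeg c.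
have [hi1|hi1] := ltP 0 (hi (idx_v c) 0).
  exists 1; split; first by left.
  move=> eps e0; have [N H] := relaxation_sign alpha_gt0 alpha_div lo0 hi1 vbox
    (fun k => v_step k c) HK (@v_tends0 c) e0.
  by exists N => k /H; rewrite mul1r.
have lo1 : lo (idx_v c) 0 < 0 by lra.
exists (-1); split; first by right.
move=> eps e0; have [N H] := relaxation_sign_ge alpha_gt0 alpha_div lo1 hi0 vbox
  (fun k => v_step k c) HK (@v_tends0 c) e0.
by exists N => k /H; rewrite mulN1r lerNl.
Qed.

(** The step of [mu] carries no noise, so the comparison lemmas apply with [rho = 0]. The slack
    [eps * elapsed k j] is not bounded over an infinite time, and only windows of bounded duration
    are controlled. *)
Lemma mu_almost_monotone (s : 'I_m -> R) :
  (forall c, (s c = 1 \/ s c = -1) /\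
    forall eps, 0 < eps -> exists N, forall k, (N <= k)%N -> s c * disagreement k c <= eps) ->
  forall eps, 0 < eps -> exists N, forall k, (N <= k)%N -> forall c j, (k <= j)%N ->
    s c * (mu j c - mu k c) <= eps * elapsed k j.
Proof.
move=> hs eps e0; apply: eventually_fin => c.
have [sc /(_ _ e0)[N HN]] := hs c; exists N => k Nk j kj.
have noise0 i l : (k <= i)%N -> (i <= l)%N -> `|\sum_(i <= r < l) (0 : R)| <= 0.
  by rewrite big1 // normr0.
have jj : (k <= j <= j)%N by rewrite kj leqnn.
case: sc HN => -> HN.
  suff : mu j c <= mu k c + 0 + eps * elapsed k j by lra.
  apply: (clip_drift_ub alpha_gt0 (box_le _) (fun i => x_box i (idx_mu c))
    (fun i => mu_step i c) (ltW e0) _ noise0 jj) => i /andP[ki _].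
  by have := HN i (leq_trans Nk ki); lra.
suff : mu k c - 0 - eps * elapsed k j <= mu j c by lra.
apply: (clip_drift_lb alpha_gt0 (box_le _) (fun i => x_box i (idx_mu c))
  (fun i => mu_step i c) (ltW e0) _ noise0 jj) => i /andP[ki _].
by have := HN i (leq_trans Nk ki); lra.
Qed.

Lemma x_bounded : exists2 D, 0 <= D & forall k c, `|x k c 0| <= D.
Proof.
exists (\sum_c (`|lo c 0| + `|hi c 0|)); first by apply: sumr_ge0 => c _; rewrite addr_ge0.
move=> k c; rewrite (bigD1 c) //=.
have : 0 <= \sum_(i < n | i != c) (`|lo i 0| + `|hi i 0|).
  by apply: sumr_ge0 => i _; rewrite addr_ge0.
have := x_box k c; rewrite ler_norml.
have := ler_norm (hi c 0); have := ler_norm (- lo c 0); rewrite normrN.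
have := normr_ge0 (hi c 0); have := normr_ge0 (lo c 0); lra.
Qed.

Lemma weighted_bounded (s : 'I_m -> R) (f : 'I_m -> 'I_n) :
  exists D, forall k, `|\sum_c s c * x k (f c) 0| <= D.
Proof.
have [D D0 HD] := x_bounded; exists (\sum_c `|s c| * D) => k.
apply: le_trans (ler_norm_sum _ _ _) _; apply: ler_sum => c _.
by rewrite normrM ler_wpM2l.
Qed.

(* [mu] cannot move during a window that starts where the almost monotone
   functional [\sum_c s c * mu c] is already close to its lower limit. *)
Lemma mu_extremal : exists mh : 'cV[R]_m,
  (forall eps N, 0 < eps -> exists k, (N <= k)%N /\
     forall c, `|mu k c - mh c 0| <= eps) /\
  forall T eps, 0 < eps -> exists2 delta, 0 < delta & exists N, forall k,
    (N <= k)%N -> (forall c, `|mu k c - mh c 0| <= delta) ->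
    forall j, (k <= j)%N -> elapsed k j < T -> forall c, `|mu j c - mh c 0| <= eps.
Proof.
have [s hs] := disagreement_sign.
have s1 c : s c = 1 \/ s c = -1 by case: (hs c).
have sabs c r : `|s c * r| = `|r|.
  by rewrite normrM; case: (s1 c) => ->; rewrite ?normrN normr1 mul1r.
pose Z k := \sum_c s c * mu k c.
have [D HD] := weighted_bounded s (@idx_mu m).
(* The lower limit of [Z] is [- sg]. Each [s c * mu k c] can hardly increase, so it is near the
   bottom of their sum that none of them can decrease either. *)
have [|||sg [H1 H2]] := @limsup_exists R (fun k => - Z k) D (fun _ _ => True).
- by move=> k; rewrite normrN; exact: HD.
- by [].
- by move=> eps N _; exists N.
have [D' D'0 HD'] := x_bounded.
have [|||z Hz] := @bounded_cluster_point R 'I_n (fun k c => x k c 0) D'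
    (fun eps k => sg - eps <= - Z k).
- exact: HD'.
- by move=> e1 e2 k h; lra.
- by move=> eps N /(H1 _ N)[k [Nk _ h]]; exists k.
pose mh := \col_c z (idx_mu c) : 'cV[R]_m.
have mhE c : mh c 0 = z (idx_mu c) by rewrite mxE.
exists mh; split.
  move=> eps N /(Hz _ N)[k [Nk _ h]]; exists k; split => // c; rewrite mhE; exact: h.
pose Zh := \sum_c s c * mh c 0.
have Z_near k eps : (forall c, `|mu k c - mh c 0| <= eps) -> `|Z k - Zh| <= m%:R * eps.
  move=> h; rewrite /Z /Zh -sumrB; apply: le_trans (ler_norm_sum _ _ _) _.
  apply: (@le_trans _ _ (\sum_(c < m) eps)).
    by apply: ler_sum => c _; rewrite -mulrBr sabs.
  by rewrite sumr_const card_ord mulr_natl.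
have m0 : 0 <= m%:R :> R by exact: ler0n.
have m1 : 0 < m%:R + 1 :> R by lra.
have Zh_le : Zh <= - sg.
  apply/ler_addgt0Pr => eps e0.
  pose e' := eps / (m%:R + 1); have e'0 : 0 < e' by rewrite divr_gt0.
  have epsE : eps = m%:R * e' + e' by rewrite /e'; field; lra.
  have [k [_ h1 h2]] := Hz _ 0%N e'0.
  have /Z_near : forall c, `|mu k c - mh c 0| <= e' by move=> c; rewrite mhE.
  rewrite ler_norml; lra.
move=> T0 eps e0; pose T := Num.max T0 0.
have T_ge0 : 0 <= T by rewrite le_max lexx orbT.
(* [q] collects multiples of [e1]: the distance of [mu] to [mh] at the start, in one coordinate and
   in [Z], the margin of [Z] above its lower limit, and the forbidden move [e1 * T] allowed to each
   of the [m] coordinates. *)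
pose q := 3 + m%:R + m%:R * T + T.
have q0 : 0 < q by rewrite /q; have := mulr_ge0 m0 T_ge0; lra.
pose e1 := eps / q; have e10 : 0 < e1 by rewrite divr_gt0.
have e1q : e1 * q = eps by rewrite /e1; field; lra.
have [N1 HN1] := mu_almost_monotone hs e10.
have [_ _ [N2 HN2]] := H2 _ e10.
exists e1 => //; exists (maxn N1 N2) => k.
rewrite geq_max => /andP[N1k N2k] hk j kj ejT c.
have eT : e1 * elapsed k j <= e1 * T.
  by apply: ler_wpM2l; [exact: ltW|rewrite le_max (ltW ejT)].
have low c' : - (e1 * T) <= - (s c' * (mu j c' - mu k c')).
  by have := HN1 k N1k c' j kj; lra.
have sumE : \sum_c' - (s c' * (mu j c' - mu k c')) = Z k - Z j.
  by rewrite sumrN -sumrB -sumrN; apply: eq_bigr => i _; ring.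
have := summand_ub (mulr_ge0 (ltW e10) T_ge0) low (lexx _) c; rewrite sumE => up.
have := Z_near _ _ hk; rewrite ler_norml => Zk.
have Zj := HN2 j (leq_trans N2k kj) I.
have e1T : 0 <= e1 * T by rewrite mulr_ge0 // ltW.
have me1T : 0 <= m%:R * (e1 * T) by rewrite mulr_ge0.
have me1 : 0 <= m%:R * e1 by rewrite mulr_ge0 // ltW.
have : `|s c * (mu j c - mu k c)| <= m%:R * e1 + e1 + m%:R * (e1 * T) + e1 * T.
  rewrite ler_norml; have := low c; lra.
rewrite sabs; have := hk c.
have epsE : eps = 3 * e1 + m%:R * e1 + m%:R * (e1 * T) + e1 * T by rewrite -e1q /q; ring.
rewrite !ler_norml; lra.
Qed.

Lemma tends0_eventually_small p (f : 'I_p -> nat -> R) :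
  (forall c, tends0 (f c)) -> forall eps, 0 < eps ->
  exists N, forall k, (N <= k)%N -> forall c, `|f c k| <= eps.
Proof. by move=> h eps e0; apply: eventually_fin => c; exact: h. Qed.

(** Of the last row of the saddle matrix only [L *m mu] survives in the limit, the contributions of
    [theta] and [v] tending to [0]. *)
Lemma w_drift_near (mh : 'cV[R]_m) eps : 0 < eps ->
  exists2 delta, 0 < delta & exists N, forall k, (N <= k)%N ->
    (forall c, `|mu k c - mh c 0| <= delta) -> forall c,
    `|- ((A *m y k) (idx_w c) 0) - (- (L *m (mh - mu_of xs)) c 0)| <= eps.
Proof.
move=> e0; have [K K0 HK] := mulmx_small L.
have K1 : 0 < 2 * (K + 1) by lra.
exists (eps / (2 * (K + 1))); first by rewrite divr_gt0.
have t1 c : tends0 (fun k => (M^T *m theta_of (y k)) c 0).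
  by apply: tends0_mulmx => j; exact: theta_tends0.
have t2 c : tends0 (fun k => (L *m v_of (y k)) c 0).
  apply: tends0_mulmx => j eps' e'0; have [N H] := v_tends0 j e'0.
  exists N => k /H; rewrite v_ofE [(x k - xs) _ _]mxE [(- xs) _ _]mxE.
  by rewrite -(v_ofE xs) xs_v mxE subr0.
have e40 : 0 < eps / 4 by lra.
have [N1 H1] := tends0_eventually_small t1 e40.
have [N2 H2] := tends0_eventually_small t2 e40.
exists (maxn N1 N2) => k; rewrite geq_max => /andP[/H1 k1 /H2 k2] hk c.
have hd j : `|(mu_of (x k) - mh) j 0| <= eps / (2 * (K + 1)).
  have -> : (mu_of (x k) - mh) j 0 = mu k j - mh j 0 by rewrite -mu_ofE !mxE.
  exact: hk.
have := HK _ _ hd c.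
have -> : K * (eps / (2 * (K + 1))) = K * eps / (2 * (K + 1)) by ring.
have : K * eps / (2 * (K + 1)) <= eps / 2.
  rewrite ler_pdivrMr //; have -> : eps / 2 * (2 * (K + 1)) = K * eps + eps by field.
  lra.
move: (k1 c) (k2 c); rewrite saddle_mulE col4_idx.
have -> : mu_of (y k) = (mu_of (x k) - mh) + (mh - mu_of xs).
  by apply/colP => i; rewrite !mxE; ring.
rewrite (mulmxDr L (mu_of (x k) - mh)); set t := M^T *m _; set r := L *m v_of _.
set a := L *m (mu_of (x k) - mh); set b := L *m (mh - _).
have -> : (- t + r + (a + b)) c 0 = - t c 0 + r c 0 + (a c 0 + b c 0) by rewrite !mxE.
rewrite !ler_norml; lra.
Qed.

(** Only moves against the drift [u] are excluded here; [w] may still follow it. Half of [e1] pays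
    for the noise and half for the accumulated error on the drift. *)
Lemma w_window k j e1 e2 (u : 'I_m -> R) : (k <= j)%N -> 0 <= e2 ->
  e2 * elapsed k j <= e1 / 2 ->
  (forall i c, (k <= i < j)%N -> u c - e2 <= - ((A *m y i) (idx_w c) 0) <= u c + e2) ->
  (forall c i l, (k <= i)%N -> (i <= l)%N ->
     `|\sum_(i <= r < l) eta r (idx_w c) 0| <= e1 / 2) ->
  forall c, (0 <= u c -> - e1 <= w j c - w k c) * (u c <= 0 -> w j c - w k c <= e1).
Proof.
move=> kj e20 eT drift noise c; have jj : (k <= j <= j)%N by rewrite kj leqnn.
split=> uc.
  suff : w k c - e1 / 2 - e2 * elapsed k j <= w j c by lra.
  apply: (clip_drift_lb alpha_gt0 (box_le _) (fun i => x_box i (idx_w c))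
    (fun i => w_step i c) e20 _ (@noise c) jj) => i kij.
  by have := drift i c kij; lra.
suff : w j c <= w k c + e1 / 2 + e2 * elapsed k j by lra.
apply: (clip_drift_ub alpha_gt0 (box_le _) (fun i => x_box i (idx_w c))
  (fun i => w_step i c) e20 _ (@noise c) jj) => i kij.
by have := drift i c kij; lra.
Qed.

(** With [mu] held near [mh], the drift of [w] is nearly [u], so [Z] can hardly decrease. Starting
    where [Z] is near its upper limit [tau] prevents it from increasing, so [w] cannot move along
    its drift either. Coordinates with [u c = 0] have no drift to follow. *)
Lemma stationary_cluster : exists z : 'cV[R]_n, forall (eps T : R) N, 0 < eps ->
  exists2 k, (N <= k)%N & forall j, (k <= j)%N -> elapsed k j < T ->
    forall c, `|x j c 0 - z c 0| <= eps.
Proof.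
have [mh [mh_freq mh_stay]] := mu_extremal.
pose u c := - (L *m (mh - mu_of xs)) c 0.
pose Z k := \sum_c Num.sg (u c) * w k c.
have [D HD] : exists D, forall k, `|Z k| <= D by exact: weighted_bounded.
pose near_mh eps k := forall c, `|mu k c - mh c 0| <= eps.
have near_mono e1 e2 k : e1 <= e2 -> near_mh e1 k -> near_mh e2 k.
  by move=> h h1 c; exact: le_trans (h1 c) h.
have [tau [H1 H2]] := @limsup_exists R Z D near_mh HD near_mono mh_freq.
have [D' D'0 HD'] := x_bounded.
have [||z Hz] := @bounded_cluster_point R 'I_n (fun k c => x k c 0) D'
    (fun eps k => near_mh eps k /\ tau - eps <= Z k) HD'.
- by move=> e1 e2 k h [h1 h2]; split; [exact: near_mono h1|lra].
- by move=> eps N /(H1 _ N)[k [Nk h1 h2]]; exists k.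
exists (\col_c z c) => eps T0 N0 e0.
have [T T_ge1 T0T] : exists2 T, 1 <= T & T0 <= T.
  by exists (Num.max T0 1); rewrite le_max lexx ?orbT.
have m0 : 0 <= m%:R :> R by exact: ler0n.
(* [e1] bounds the backward moves of [w] during the window. *)
have [e1 e10 epsE] : exists2 e1, 0 < e1 & eps = 3 * e1 + m%:R * e1.
  exists (eps / (3 + m%:R)); first by rewrite divr_gt0 //; lra.
  by field; lra.
have [e2 e2_gt0 e2T] : exists2 e2, 0 < e2 & e2 * T = e1 / 2.
  by exists (e1 / (2 * T)); [rewrite divr_gt0 //; lra|field; lra].
have e3_gt0 : 0 < e1 / 2 by lra.
have [d1 d10 [N1 HN1]] := w_drift_near mh e2_gt0.
have [d2 d20 [N2 HN2]] := H2 _ e10.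
have d12 : 0 < Num.min e1 (Num.min d1 d2) by rewrite !lt_min e10 d10 d20.
have [d3 d30 [N3 HN3]] := mh_stay T _ d12.
have [N4 HN4] := tends0_eventually_small theta_tends0 e3_gt0.
have [N5 HN5] := tends0_eventually_small v_tends0 e3_gt0.
have [N6 HN6] : exists N, forall k, (N <= k)%N -> forall c l, (k <= l)%N ->
    `|\sum_(k <= i < l) eta i (idx_w c) 0| <= e1 / 2.
  by apply: eventually_fin => c; have [N HN] := eta_csum (idx_w c) e3_gt0;
    exists N => k Nk l; exact: HN.
have dmin : 0 < Num.min d3 (e1 / 2) by rewrite lt_min d30.
have [k [Nk [nk Zk] zk]] :=
  Hz _ (maxn N0 (maxn N1 (maxn N2 (maxn N3 (maxn N4 (maxn N5 N6)))))) dmin.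
move: Nk; rewrite !geq_max => /and5P[Nk0 Nk1 Nk2 Nk3 /and3P[Nk4 Nk5 Nk6]].
have [mind3 mine1] : Num.min d3 (e1 / 2) <= d3 /\ Num.min d3 (e1 / 2) <= e1 / 2.
  by rewrite !ge_min !lexx orbT.
exists k => // j kj ejT0.
have ejT := lt_le_trans ejT0 T0T.
have stay i : (k <= i <= j)%N -> near_mh (Num.min e1 (Num.min d1 d2)) i.
  move=> /andP[ki ij]; apply: (HN3 k Nk3 (near_mono _ _ _ mind3 nk) i ki).
  apply: le_lt_trans ejT; rewrite (big_cat_nat (n := i) (p := j)) //= lerDl.
  exact: elapsed_ge0.
have [min1 min2 min3] : [/\ Num.min e1 (Num.min d1 d2) <= e1,
    Num.min e1 (Num.min d1 d2) <= d1 & Num.min e1 (Num.min d1 d2) <= d2].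
  by split; rewrite !ge_min lexx ?orbT.
have drift i c : (k <= i < j)%N ->
    u c - e2 <= - ((A *m y i) (idx_w c) 0) <= u c + e2.
  move=> /andP[ki ij]; have kij : (k <= i <= j)%N by rewrite ki ltnW.
  rewrite -ler_distl.
  exact: HN1 i (leq_trans Nk1 ki) (near_mono _ _ _ min2 (stay i kij)) c.
have jj : (k <= j <= j)%N by rewrite kj leqnn.
have noise c i l : (k <= i)%N -> (i <= l)%N ->
    `|\sum_(i <= r < l) eta r (idx_w c) 0| <= e1 / 2.
  by move=> ki; exact: HN6 (leq_trans Nk6 ki) c l.
have eT : e2 * elapsed k j <= e1 / 2.
  by rewrite -e2T; apply: ler_wpM2l; exact: ltW.
have wmoves := w_window kj (ltW e2_gt0) eT drift noise.
(* The bound by [tau] holds only along indices where [mu] is near [mh]; it is available at [j]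
   because [mu] stayed there during the window. *)
have Zj := HN2 j (leq_trans Nk2 kj) (near_mono _ _ _ min3 (stay j jj)).
have sumE : \sum_c Num.sg (u c) * (w j c - w k c) <= 2 * e1.
  have -> : \sum_c Num.sg (u c) * (w j c - w k c) = Z j - Z k.
    by rewrite -sumrB; apply: eq_bigr => i _; rewrite mulrBr.
  lra.
have wstay := signed_moves_small (ltW e10) (fun c => (wmoves c).1)
  (fun c => (wmoves c).2) sumE.
have me1 := mulr_ge0 m0 (ltW e10).
apply: idx4P => c; rewrite [(\col_i z i) _ _]mxE.
- have := HN4 k Nk4 c; have := HN4 j (leq_trans Nk4 kj) c; have := zk (idx_th c).
  rewrite !theta_ofE [(x j - xs) _ _]mxE [(x k - xs) _ _]mxE !ler_norml; lra.
- have := HN5 k Nk5 c; have := HN5 j (leq_trans Nk5 kj) c; have := zk (idx_v c).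
  rewrite !ler_norml; lra.
- have := nk c; have := stay j jj c; have := zk (idx_mu c).
  rewrite !ler_norml; lra.
- have : `|w j c - w k c| <= 2 * e1 + m%:R * e1.
    by apply: le_trans (wstay c) _; rewrite ge_max lexx andbT; lra.
  have := zk (idx_w c); rewrite !ler_norml; lra.
Qed.

Theorem saddle_convergence : exists z : 'cV[R]_n, [/\ box lo hi z,
  forall y, box lo hi y -> dotv (A *m (z - xs)) (z - y) <= 0 &
  tends0 (fun k => dotv (x k - z) (x k - z))].
Proof.
have [z Hz] := stationary_cluster; exists z.
have cluster eps N : 0 < eps ->
    exists2 k, (N <= k)%N & forall c, `|x k c 0 - z c 0| <= eps.
  move=> /(Hz _ 1 N)[k Nk hk]; exists k => //.
  by apply: hk; rewrite ?leqnn // big_geq.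
have VI y' : box lo hi y' -> dotv (A *m (z - xs)) (z - y') <= 0.
  exact: (window_variational_ineq x_box alpha_gt0 alpha_div alpha_sq xS B_ge0
    incr_bound eta_csum eta_x_csum).
split => //.
  by apply: (near_box x_box) => eps /(cluster _ 0%N)[k _ h]; exists k.
exact: (cluster_solution_limit saddle_monotone x_box alpha_gt0 alpha_sq xS B_ge0
    incr_bound eta_csum eta_x_csum).
Qed.

End SaddleConvergence.

(** * Almost sure convergence of martingale series *)

Section BoundedExpectation.
Context d (T : measurableType d) (R : realType) (P : probability T R).
Implicit Types f g : T -> R.

Definition bdmeas f := measurable_fun setT f /\ exists B, forall t, `|f t| <= B.

Local Notation Ex f := (\int[P]_t f t).

Lemma bdmeas_integrable f : bdmeas f -> P.-integrable setT (EFin \o f).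
Proof.
move=> [mf [B fB]]; apply: measurable_bounded_integrable => //.
  by rewrite (le_lt_trans (probability_le1 P measurableT)) // ltry.
exists B; split; first exact: num_real.
by move=> y By t _; apply: le_trans (fB t) _; exact: ltW.
Qed.

Lemma bdmeas_cst r : bdmeas (fun=> r).
Proof. by split; [exact: measurable_cst|exists `|r|]. Qed.

Lemma bdmeasD f g : bdmeas f -> bdmeas g -> bdmeas (fun t => f t + g t).
Proof.
move=> [mf [B fB]] [mg [C gC]]; split; first exact: measurable_funD.
exists (B + C) => t; apply: le_trans (ler_normD _ _) _.
by have := fB t; have := gC t; lra.
Qed.

Lemma bdmeasM f g : bdmeas f -> bdmeas g -> bdmeas (fun t => f t * g t).
Proof.
move=> [mf [B fB]] [mg [C gC]]; split; first exact: measurable_funM.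
by exists (B * C) => t; rewrite normrM; apply: ler_pM.
Qed.

Lemma bdmeas_indic (A : set T) : measurable A -> bdmeas (fun t => \1_A t).
Proof.
move=> mA; split; first exact: measurable_indic.
by exists 1 => t; rewrite indicE; case: (_ \in _); rewrite /= ?normr1 ?normr0.
Qed.

Lemma bdmeas_sum (I : Type) (r : seq I) (h : I -> T -> R) :
  (forall i, bdmeas (h i)) -> bdmeas (fun t => \sum_(i <- r) h i t).
Proof.
move=> hh; elim: r => [|i r IH].
  by under eq_fun do rewrite big_nil; exact: bdmeas_cst.
by under eq_fun do rewrite big_cons; exact: bdmeasD.
Qed.

Lemma Ex_cst r : Ex (fun=> r) = r.
Proof.
rewrite Rintegral_cst // -[RHS]mulr1; congr (_ * _).
by have /(congr1 fine) := @probability_setT _ _ _ P.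
Qed.

Lemma ExD f g : bdmeas f -> bdmeas g -> Ex (fun t => f t + g t) = Ex f + Ex g.
Proof. by move=> hf hg; rewrite RintegralD //; exact: bdmeas_integrable. Qed.

Lemma ExZ r f : bdmeas f -> Ex (fun t => r * f t) = r * Ex f.
Proof. by move=> hf; rewrite RintegralZl //; exact: bdmeas_integrable. Qed.

Lemma Ex_sum (I : Type) (r : seq I) (h : I -> T -> R) :
  (forall i, bdmeas (h i)) ->
  Ex (fun t => \sum_(i <- r) h i t) = \sum_(i <- r) Ex (h i).
Proof.
move=> hh; elim: r => [|i r IH].
  by rewrite big_nil; under eq_Rintegral do rewrite big_nil; rewrite Ex_cst.
rewrite big_cons -IH; under eq_Rintegral do rewrite big_cons.
by rewrite ExD //; exact: bdmeas_sum.
Qed.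

Lemma le_Ex f g : bdmeas f -> bdmeas g -> (forall t, f t <= g t) -> Ex f <= Ex g.
Proof.
by move=> hf hg h; apply: le_Rintegral => //; exact: bdmeas_integrable.
Qed.

Lemma Ex_norm_le f c : bdmeas f -> (forall t, `|f t| <= c) -> `|Ex f| <= c.
Proof.
move=> hf h; rewrite ler_norml -(Ex_cst (- c)) -[X in _ && (_ <= X)]Ex_cst.
by apply/andP; split; apply: le_Ex => // [|t]; (try exact: bdmeas_cst);
   have := h t; rewrite ler_norml => /andP[].
Qed.

Lemma Ex_indic (A : set T) : measurable A -> (Ex (fun t => \1_A t))%:E = P A.
Proof.
move=> mA; rewrite /Rintegral integral_indic // setIT fineK //.
exact: fin_num_measure.
Qed.

End BoundedExpectation.

(** The sum is the integer part of [y], capped at [M]. A bounded nonnegative function is thus, up to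
    [1], a sum of indicators of its level sets. *)
Lemma threshold_count (R : realType) (M : nat) (y : R) : 0 <= y ->
  (M%:R <= y -> \sum_(j < M) ((j.+1%:R <= y)%R%:R : R) = M%:R) /\
  (y < M%:R -> y - 1 <= \sum_(j < M) ((j.+1%:R <= y)%R%:R : R) <= y).
Proof.
move=> y0; elim: M => [|M [IH1 IH2]].
  by rewrite big_ord0; split => // h; lra.
rewrite big_ord_recr /=; have Ms : M.+1%:R = M%:R + 1 :> R by rewrite -natr1.
split=> h; first by rewrite h IH1 ?Ms //; lra.
have -> : (M.+1%:R <= y) = false by rewrite leNgt h.
rewrite addr0; have [My|yM] := leP M%:R y; last exact: IH2.
by rewrite IH1 //; lra.
Qed.

Section Independence.
Context d (T : measurableType d) (R : realType) (P : probability T R).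
Local Notation Ex f := (\int[P]_t f t).

(** The defect [phi] of the product formula is linear and vanishes on indicators of sets of [F]. Up
    to constants, [c * Y] is within [1] of a sum of such indicators, so [c * phi Y] is at most
    [1 + |p|] in absolute value, for arbitrarily large [c]. *)
Lemma independent_expectation (F : set (set T)) (A : set T) (p : R) (Y : T -> R) (B : R) :
  measurable A -> (forall E, F E -> measurable E) ->
  (forall E, F E -> P (A `&` E) = (p%:E * P E)%E) ->
  (forall E, measurable E -> F (Y @^-1` E)) -> (forall t, `|Y t| <= B) ->
  Ex (fun t => Y t * \1_A t) = p * Ex Y.
Proof.
move=> mA mF hA FY YB.
have mY : measurable_fun setT Y by move=> _ E mE; rewrite setTI; exact/mF/FY.
have bY : bdmeas Y by split => //; exists B.
have bA := bdmeas_indic R mA.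
have Eset E : F E -> Ex (fun t => \1_E t * \1_A t) = p * Ex (fun t => \1_E t).
  move=> FE; have mE := mF _ FE; apply: EFin_inj; rewrite EFinM Ex_indic // -hA //.
  have mAE : measurable (A `&` E) by exact: measurableI.
  rewrite -(Ex_indic P mAE); congr EFin; apply: eq_Rintegral => t _.
  by rewrite indicI /= mulrC.
apply/eqP; rewrite -subr_eq0 -normr_le0; apply/ler_addgt0Pr => eps e0; rewrite add0r.
have p1 : 0 < 1 + `|p| by have := normr_ge0 p; lra.
pose n := Num.trunc ((1 + `|p|) / eps); pose c : R := n.+1%:R.
have c0 : 0 < c by rewrite ltr0n.
have hc : (1 + `|p|) / c <= eps.
  rewrite ler_pdivrMr // mulrC -ler_pdivrMr //; apply: ltW.
  exact: truncnS_gt.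
have B0 : 0 <= B by exact: le_trans (YB point).
(* [y] is within 1 of the number [S] of integer thresholds that it exceeds, a
   combination of indicators. *)
pose y t := c * (Y t + B).
have y0 t : 0 <= y t.
  by apply: mulr_ge0; [exact: ltW|have := YB t; rewrite ler_norml; lra].
pose M := (Num.trunc (c * (B + B))).+1.
have yM t : y t < M%:R.
  apply: le_lt_trans (truncnS_gt _); apply: ler_wpM2l; first exact: ltW.
  by have := YB t; rewrite ler_norml; lra.
pose E (j : nat) := [set t | j.+1%:R <= y t].
have FE j : F (E j).
  have -> : E j = Y @^-1` [set r | j.+1%:R <= c * (r + B)] by [].
  apply: FY; rewrite -[X in measurable X]setTI.
  by apply: measurable_fun_ler => //; apply: measurable_funM => //; exact: measurable_funD.
have bE j : bdmeas (fun t => \1_(E j) t : R) by apply: bdmeas_indic; exact/mF.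
pose S t : R := \sum_(j < M) \1_(E j) t.
have bS : bdmeas S by exact: bdmeas_sum.
have S_near t : `|y t - S t| <= 1.
  have [_ /(_ (yM t))] := threshold_count M (y0 t).
  have -> : \sum_(j < M) (j.+1%:R <= y t)%R%:R = S t.
    by apply: eq_bigr => j _; rewrite indicE; suff -> : (j.+1%:R <= y t) = (t \in E j) by [];
    apply/idP/idP; rewrite inE.
  by rewrite ler_norml; lra.
pose phi f := Ex (fun t => f t * \1_A t) - p * Ex f.
have phiD f g : bdmeas f -> bdmeas g -> phi (fun t => f t + g t) = phi f + phi g.
  move=> bf bg; rewrite /phi ExD //; under eq_Rintegral do rewrite mulrDl.
  by rewrite ExD //; [ring|exact: bdmeasM|exact: bdmeasM].
have phiZ r f : bdmeas f -> phi (fun t => r * f t) = r * phi f.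
  move=> bf; rewrite /phi ExZ //; under eq_Rintegral do rewrite -mulrA.
  by rewrite ExZ //; [ring|exact: bdmeasM].
have phiS : phi S = 0.
  rewrite /phi Ex_sum //; under eq_Rintegral do rewrite mulr_suml.
  rewrite Ex_sum => [|j]; last exact: bdmeasM.
  by rewrite mulr_sumr -sumrB big1 // => j _; rewrite Eset // subrr.
have phi1 : phi (fun=> 1) = 0.
  have FT : F setT by rewrite -(preimage_setT Y); exact: FY.
  have := Eset _ FT; rewrite /phi.
  under eq_Rintegral do rewrite indicE in_setT.
  move=> ->; rewrite -mulrBr; under [X in _ * (X - _)]eq_Rintegral do rewrite indicE in_setT.
  by rewrite subrr mulr0.
pose Z t := c * Y t + (c * B * 1 + -1 * S t).
have b1 : bdmeas (fun _ : T => 1 : R) by exact: bdmeas_cst.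
have bZr r f : bdmeas f -> bdmeas (fun t : T => r * f t : R).
  by move=> bf; apply: bdmeasM => //; exact: bdmeas_cst.
have bZ : bdmeas Z by apply: bdmeasD; [|apply: bdmeasD]; exact: bZr.
have phiZE : phi Z = c * phi Y.
  rewrite phiD; [|exact: bZr|by apply: bdmeasD; exact: bZr].
  rewrite phiD; [|exact: bZr|exact: bZr].
  by rewrite !phiZ // phi1 phiS !mulr0 !addr0.
have Z1 t : `|Z t| <= 1.
  suff -> : Z t = y t - S t by exact: S_near.
  by rewrite /Z /y; ring.
have : `|phi Z| <= 1 + `|p|.
  apply: le_trans (ler_normB _ _) _; rewrite normrM; apply: lerD.
    apply: (Ex_norm_le P) => [|t]; first exact: bdmeasM.
    rewrite normrM -[1]mulr1; apply: ler_pM => //.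
    by rewrite indicE; case: (_ \in _); rewrite /= ?normr1 ?normr0.
  by rewrite -[X in _ <= X]mulr1 ler_wpM2l //; exact: Ex_norm_le.
rewrite phiZE normrM (gtr0_norm c0) => h; apply: le_trans hc.
by rewrite ler_pdivlMr // mulrC.
Qed.

End Independence.

Section MartingaleConvergence.
Context d (T : measurableType d) (R : realType) (P : probability T R).
Variables (G : nat -> set (set T)) (D : nat -> T -> R) (beta : nat -> R).

Local Notation Ex f := (\int[P]_t f t).
(** [G k] is only a generating family, so inclusions need checking on generators alone. The
    martingale property is likewise stated by testing [D k] against bounded adapted functions,
    without a conditional expectation. *)
Definition adapted k (Y : T -> R) :=
  measurable_fun (setT : set (g_sigma_algebraType (G k))) Y.

Hypothesis G_measurable : forall k, G k `<=` measurable.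
Hypothesis G_incr : forall k, G k `<=` G k.+1.
Hypothesis D_adapted : forall k, adapted k.+1 (D k).
Hypothesis D_bounded : forall k t, `|D k t| <= beta k.
Hypothesis D_centered : forall k Y, adapted k Y ->
  (exists B, forall t, `|Y t| <= B) -> Ex (fun t => Y t * D k t) = 0.
Hypothesis beta_sq : csum (fun k => beta k ^+ 2).

Lemma adapted_measurable k Y : adapted k Y -> measurable_fun setT Y.
Proof.
move=> h mT E mE; have := h measurableT E mE; rewrite !setTI.
apply: smallest_sub; first exact: sigma_algebra_measurable.
exact: G_measurable.
Qed.

Lemma adaptedS k Y : adapted k Y -> adapted k.+1 Y.
Proof.
move=> h mT E mE; have := h measurableT E mE.
by apply: sub_sigma_algebra2; exact: G_incr.
Qed.

(* Freezing the partial sums once they reach [eps] reduces the maximal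
   inequality to the Chebyshev inequality. *)
Fixpoint stopped eps m n t : R :=
  if n is n'.+1 then stopped eps m n' t +
    (if `|stopped eps m n' t| < eps then D (m + n') t else 0) else 0.

(** A frozen value never returns below [eps]. Ending below [eps] means never having been frozen, and
    the process then coincides with the partial sums. *)
Lemma stoppedP eps m n t : 0 < eps -> `|stopped eps m n t| < eps ->
  forall j, (j <= n)%N -> `|\sum_(m <= i < m + j) D i t| < eps.
Proof.
move=> e0 hn.
suff H j : (j <= n)%N -> stopped eps m j t = \sum_(m <= i < m + j) D i t /\
    `|stopped eps m j t| < eps.
  by move=> j /H[<-].
have frozen i l : (i <= l)%N -> eps <= `|stopped eps m i t| ->
    eps <= `|stopped eps m l t|.
  elim: l => [|l IH]; first by rewrite leqn0 => /eqP ->.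
  rewrite leq_eqVlt => /orP[/eqP <- //|]; rewrite ltnS => il h.
  by have := IH il h => /= h'; rewrite ltNge h' addr0.
move=> jn; have small i : (i <= n)%N -> `|stopped eps m i t| < eps.
  by move=> le_in; rewrite ltNge; apply/negP => /(frozen _ _ le_in); rewrite leNgt hn.
split; last exact: small.
elim: j jn => [|j IH] jn; first by rewrite addn0 big_geq.
by rewrite /= IH ?(ltnW jn) // -IH ?(ltnW jn) // small ?(ltnW jn) // addnS
  big_nat_recr ?leq_addr //= -IH ?(ltnW jn).
Qed.

Lemma stopped_adapted eps m n : adapted (m + n) (stopped eps m n).
Proof.
elim: n => [|n IH]; first exact: measurable_cst.
rewrite addnS; apply: measurable_funD; first exact: adaptedS.
apply: measurable_fun_ifT; [|exact: D_adapted|exact: measurable_cst].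
apply: measurable_fun_ltr; last exact: measurable_cst.
by apply: measurableT_comp => //; exact: adaptedS.
Qed.

Lemma stopped_bounded eps m n : exists B, forall t, `|stopped eps m n t| <= B.
Proof.
elim: n => [|n [B IH]]; first by exists 0 => t; rewrite /= normr0.
exists (B + beta (m + n)) => t; apply: le_trans (ler_normD _ _) _.
apply: lerD => //; case: ifP => _ //.
by rewrite normr0; exact: le_trans (normr_ge0 _) (D_bounded _ t).
Qed.

Lemma stopped_bdmeas eps m n : bdmeas (stopped eps m n).
Proof.
split; last exact: stopped_bounded.
by apply: (@adapted_measurable (m + n)%N); exact: stopped_adapted.
Qed.

(** Orthogonality of increments: the stopped value [Q] and the indicator [H] of not being frozen are
    both known before [D (m + n)] is drawn, so the cross term has zero expectation. *)
Lemma stopped_sqr_le eps m n :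
  Ex (fun t => stopped eps m n t ^+ 2) <= \sum_(m <= i < m + n) beta i ^+ 2.
Proof.
elim: n => [|n IH].
  rewrite addn0 big_geq //; under eq_Rintegral do rewrite expr0n /=.
  by rewrite Ex_cst.
rewrite addnS big_nat_recr ?leq_addr //=.
pose Q := stopped eps m n.
pose H t : R := if `|Q t| < eps then 1 else 0.
have aH : adapted (m + n) H.
  apply: measurable_fun_ifT; [|exact: measurable_cst|exact: measurable_cst].
  apply: measurable_fun_ltr; last exact: measurable_cst.
  by apply: measurableT_comp => //; exact: stopped_adapted.
have H1 t : `|H t| <= 1 by rewrite /H; case: ifP => _; rewrite ?normr0 ?normr1.
have bQ := stopped_bdmeas eps m n.
have bH : bdmeas H by split; [exact: adapted_measurable aH|exists 1].
have bD : bdmeas (D (m + n)).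
  split; last by exists (beta (m + n)%N).
  by apply: (@adapted_measurable (m + n)%N.+1); exact: D_adapted.
have bQQ : bdmeas (fun t => Q t * Q t) by exact: bdmeasM.
have bQHD : bdmeas (fun t => 2 * ((Q t * H t) * D (m + n) t)).
  by apply: bdmeasM; [exact: bdmeas_cst|do 2 apply: bdmeasM => //].
have bHD : bdmeas (fun t => (H t * D (m + n) t) * (H t * D (m + n) t)).
  by apply: bdmeasM; exact: bdmeasM.
have E t : stopped eps m n.+1 t ^+ 2 = (Q t * Q t +
    2 * ((Q t * H t) * D (m + n) t)) + (H t * D (m + n) t) * (H t * D (m + n) t).
  by rewrite /= -/Q /H; case: ifP => _; ring.
rewrite (eq_Rintegral _ (fun t _ => E t)) ExD; [|exact: bdmeasD|by []].
rewrite ExD // ExZ; last by do 2 apply: bdmeasM => //.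
have -> : Ex (fun t => Q t * H t * D (m + n) t) = 0.
  apply: D_centered; first by apply: measurable_funM => //; exact: stopped_adapted.
  by have [_] := bdmeasM bQ bH.
rewrite mulr0 addr0; apply: lerD.
  by move: IH; under eq_Rintegral do rewrite expr2.
rewrite -(Ex_cst P (beta _ ^+ 2)); apply: le_Ex => //; first exact: bdmeas_cst.
move=> t; rewrite -expr2; apply: sqr_le_norm; rewrite normrM -[`|beta _|]mul1r.
by apply: ler_pM => //; exact: le_trans (D_bounded _ t) (ler_norm _).
Qed.

Lemma stopped_prob_le eps m n : 0 < eps ->
  (P [set t | (eps <= `|stopped eps m n t|)%R] <=
   (eps ^- 2 * \sum_(m <= i < m + n) beta i ^+ 2)%:E)%E.
Proof.
move=> e0; set V := [set t | _].
have [mQ bQ] := stopped_bdmeas eps m n.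
have mV : measurable V.
  rewrite -[V]setTI; apply: measurable_fun_ler => //.
  exact: measurableT_comp.
have bV := bdmeas_indic R mV.
have e2 : 0 < eps ^+ 2 by rewrite exprn_gt0.
rewrite -(Ex_indic P mV) lee_fin -ler_pdivrMl ?invr_gt0 // invrK.
apply: le_trans (stopped_sqr_le eps m n); rewrite -ExZ //; apply: le_Ex.
- by apply: bdmeasM => //; exact: bdmeas_cst.
- by under eq_fun do rewrite expr2; apply: bdmeasM; exact: stopped_bdmeas.
move=> t; rewrite indicE; case: (boolP (t \in V)) => [|_]; rewrite /= ?mulr1 ?mulr0 ?sqr_ge0 //.
by rewrite inE /V /= => h; apply: sqr_le_norm; rewrite gtr0_norm.
Qed.

Lemma eventually_small_oscillation eps : 0 < eps ->
  {ae P, forall t, exists m, forall j, `|\sum_(m <= i < m + j) D i t| < eps}.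
Proof.
move=> e0.
pose V m n := [set t | (eps <= `|stopped eps m n t|)%R].
have mV m n : measurable (V m n).
  rewrite -[V m n]setTI; apply: measurable_fun_ler => //.
  by apply: measurableT_comp => //; have [] := stopped_bdmeas eps m n.
have mU m : measurable (\bigcup_n V m n) by exact: bigcupT_measurable.
pose W := \bigcap_m \bigcup_n V m n.
have mW : measurable W by exact: bigcapT_measurable.
exists W; split => //; last first.
  move=> t /= not_small m _; apply: contrapT => notV; apply: not_small.
  exists m => j; apply: (@stoppedP eps m j t e0 _ j (leqnn j)).
  by rewrite ltNge; apply/negP => h; apply: notV; exists j.
apply/eqP; rewrite eq_le measure_ge0 andbT; apply/lee_addgt0Pr => r r0; rewrite add0e.
have [N HN] := beta_sq (mulr_gt0 r0 (exprn_gt0 2 e0)).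
apply: (@le_trans _ _ (P (\bigcup_n V N n))).
  by apply: le_measure; rewrite ?inE //; move=> t /(_ N I).
(* Freezing makes the events increase with [n], so continuity from below carries the Chebyshev
   bound, uniform in [n], over to their union. The tail was chosen below [r * eps ^+ 2] to cancel
   the factor [eps ^- 2]. *)
have nd : nondecreasing_seq (V N).
  move=> i j ij; apply/subsetPset => t; rewrite /V /= => h.
  elim: j ij => [|j IH]; first by rewrite leqn0 => /eqP <-.
  rewrite leq_eqVlt => /orP[/eqP <- //|]; rewrite ltnS => /IH h' /=.
  by rewrite ltNge h' addr0.
have cv := @nondecreasing_cvg_mu _ _ _ P _ (mV N) (mU N) nd.
rewrite -(cvg_lim _ cv) //; apply: lime_le; first exact: cvgP cv.
apply: nearW => n /=; apply: le_trans (stopped_prob_le _ _ e0) _.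
rewrite lee_fin mulrC ler_pdivrMr ?exprn_gt0 //.
by apply: le_trans (ler_norm _) (HN N (N + n)%N (leqnn _) (leq_addr _ _)).
Qed.

Theorem martingale_csum : {ae P, forall t, csum (fun k => D k t)}.
Proof.
have h (n : nat) : {ae P, forall t, exists m, forall j,
    `|\sum_(m <= i < m + j) D i t| < n.+1%:R^-1}.
  by apply: eventually_small_oscillation; rewrite invr_gt0 ltr0n.
have := ae_foralln h; apply: filterS => t ht eps e0.
have e20 : 0 < eps / 2 by lra.
pose n := Num.trunc (2 / eps).
have hn : (n.+1%:R^-1 : R) <= eps / 2.
  rewrite -[eps / 2]invrK lef_pV2 ?posrE ?invr_gt0 ?ltr0n // invf_div.
  exact/ltW/truncnS_gt.
have [m hm] := ht n; exists m => k l mk kl.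
move: (n.+1%:R^-1 : R) hn hm => r hn hm.
have := hm (k - m)%N; have := hm (l - m)%N.
rewrite !subnKC ?(leq_trans mk) // (big_cat_nat (m := m) (n := k) (p := l)) //=.
rewrite !ltr_norml ler_norml; lra.
Qed.

End MartingaleConvergence.

(** * Sampling errors *)

Section SamplingNoise.
Context (R : realType) (disp : measure_display) (T : measurableType disp).
Variables (P : probability T R) (n : nat) (I : Type) (Z : finType).
Variables (X : nat -> I -> T -> Z) (x : nat -> T -> 'cV[R]_n) (p : Z -> R).
Variables (lo hi : 'cV[R]_n) (alpha : nat -> R).

Hypothesis X_meas : forall k i z, measurable (X k i @^-1` [set z]).
Hypothesis x_meas : forall k c, measurable_fun setT (fun t => x k t c 0).
Hypothesis X_law : forall k i z,
  is_cond_prob P (past X x k) (X k i @^-1` [set z]) (cst (p z)).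
Hypothesis x_box : forall k t, box lo hi (x k.+1 t).
Hypothesis alpha_sq : csum (fun k => alpha k ^+ 2).

Local Notation Ex f := (\int[P]_t f t).

Definition past_generator k : set (set T) :=
  [set E | exists j i z, (j < k)%N /\ E = X j i @^-1` [set z]] `|`
  [set E | exists j c (B : set R), [/\ (j <= k)%N, measurable B &
     E = (fun t => x j t c 0) @^-1` B]].

Lemma past_generator_measurable k : past_generator k `<=` measurable.
Proof.
move=> E [[j [i [z [_ ->]]]]|[j [c [B [_ mB ->]]]]]; first exact: X_meas.
by rewrite -[X in measurable X]setTI; exact: x_meas.
Qed.

Lemma past_measurable k E : past X x k E -> measurable E.
Proof.
apply: smallest_sub; first exact: sigma_algebra_measurable.
exact: past_generator_measurable.
Qed.

Lemma past_generatorS k : past_generator k `<=` past_generator k.+1.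
Proof.
move=> E [[j [i [z [jk ->]]]]|[j [c [B [jk mB ->]]]]]; [left|right].
  by exists j, i, z; split => //; exact: ltnW.
by exists j, c, B; split => //; exact: leqW.
Qed.

Lemma coord_adapted k c : adapted past_generator k (fun t => x k t c 0).
Proof.
move=> mT B mB; rewrite setTI; apply: sub_sigma_algebra; right.
by exists k, c, B.
Qed.

Lemma sample_adapted k i z :
  adapted past_generator k.+1 (fun t => \1_(X k i @^-1` [set z]) t : R).
Proof.
apply: measurable_indic; apply: sub_sigma_algebra; left.
by exists k, i, z.
Qed.

(** The law of one agent's sample given the past is all that enters, whatever the dependence between
    agents. A general polynomial [c] covers both the sampled drift and its product with a coordinate
    of the iterate. *)
Lemma sampling_noise_csum i (c : Z -> 'cV[R]_n -> R) : (forall z, polyf (c z)) ->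
  {ae P, forall t, csum (fun k => alpha k.+1 *
     (c (X k.+1 i t) (x k.+1 t) - \sum_z p z * c z (x k.+1 t)))}.
Proof.
move=> pc.
have [B hB] : exists B : Z -> R, forall z, 0 <= B z /\
    forall u, box lo hi u -> `|c z u| <= B z.
  suff h z : exists b, 0 <= b /\ forall u, box lo hi u -> `|c z u| <= b.
    by have [B hB] := choice h; exists B.
  by have [b b0 hb] := polyf_bounded lo hi (pc z); exists b.
pose S k z := X k i @^-1` [set z].
(* Splitting over the finitely many samples separates the fresh sample, seen through indicators,
   from the iterate, which belongs to the past. *)
have cX k t : c (X k i t) (x k t) = \sum_z \1_(S k z) t * c z (x k t).
  rewrite (bigD1 (X k i t)) //= big1 ?addr0 => [|z zX].
    by rewrite indicE mem_set // mul1r.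
  by rewrite indicE memNset ?mul0r // => h; move: zX; rewrite -h eqxx.
pose D k t := alpha k.+1 * \sum_z (\1_(S k.+1 z) t - p z) * c z (x k.+1 t).
have DE k t : D k t = alpha k.+1 *
    (c (X k.+1 i t) (x k.+1 t) - \sum_z p z * c z (x k.+1 t)).
  by rewrite cX -sumrB; congr (_ * _); apply: eq_bigr => z _; rewrite mulrBl.
pose b := \sum_z (1 + `|p z|) * B z.
pose G k := past_generator k.+1.
have ac k z : adapted G k (fun t => c z (x k.+1 t)).
  by apply: polyf_measurable => // c'; exact: coord_adapted.
have bc k z t : `|c z (x k.+1 t)| <= B z by have [_] := hB z; apply; exact: x_box.
have G_meas k : G k `<=` measurable by exact: past_generator_measurable.
have G_incr k : G k `<=` G k.+1 by exact: past_generatorS.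
have meas k Y : adapted G k Y -> measurable_fun setT Y by exact: adapted_measurable.
have bdc k z : bdmeas (fun t => c z (x k.+1 t)).
  by split; [exact: meas (ac k z)|exists (B z)].
have ind1 (A : set T) t : `|\1_A t| <= 1 :> R.
  by rewrite indicE; case: (_ \in _); rewrite /= ?normr1 ?normr0.
have b_sq : csum (fun k => (`|alpha k.+1| * b) ^+ 2).
  have h : csum (fun k => b ^+ 2 * alpha k.+1 ^+ 2).
    apply: csumZ => eps /alpha_sq[N HN]; exists N => k l Nk kl.
    by have := HN k.+1 l.+1 (leqW Nk) kl; rewrite big_add1 /=.
  by apply: eq_csum h => k; rewrite exprMn real_normK ?num_real // mulrC.
have D_adapted k : adapted G k.+1 (D k).
  apply: measurable_funM; first exact: measurable_cst.
  apply: measurable_sum => z; apply: measurable_funM.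
    by apply: measurable_funB; [exact: sample_adapted|exact: measurable_cst].
  exact: adaptedS.
have D_bounded k t : `|D k t| <= `|alpha k.+1| * b.
  rewrite normrM ler_wpM2l //; apply: le_trans (ler_norm_sum _ _ _) _.
  apply: ler_sum => z _; rewrite normrM; apply: ler_pM => //.
  by apply: le_trans (ler_normB _ _) _; rewrite lerD2r.
have D_centered k Y : adapted G k Y -> (exists C, forall t, `|Y t| <= C) ->
    Ex (fun t => Y t * D k t) = 0.
  move=> aY [C YC].
  have bY : bdmeas Y by split; [exact: meas aY|exists C].
  have bYc z : bdmeas (fun t => Y t * c z (x k.+1 t)) by exact: bdmeasM.
  have bS z : bdmeas (fun t => \1_(S k.+1 z) t : R) by apply: bdmeas_indic; exact: X_meas.
  have E t : Y t * D k t = alpha k.+1 * \sum_z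
      ((Y t * c z (x k.+1 t)) * \1_(S k.+1 z) t + - p z * (Y t * c z (x k.+1 t))).
    rewrite /D mulrCA; congr (_ * _); rewrite mulr_sumr.
    by apply: eq_bigr => z _; ring.
  have bpYc z : bdmeas (fun t => - p z * (Y t * c z (x k.+1 t))).
    by apply: bdmeasM => //; exact: bdmeas_cst.
  have bterm z : bdmeas (fun t => (Y t * c z (x k.+1 t)) * \1_(S k.+1 z) t
      + - p z * (Y t * c z (x k.+1 t))).
    by apply: bdmeasD => //; exact: bdmeasM.
  rewrite (eq_Rintegral _ (fun t _ => E t)) ExZ; last exact: bdmeas_sum.
  rewrite Ex_sum // big1 ?mulr0 // => z _.
  rewrite ExD //; last exact: bdmeasM.
  rewrite ExZ //.
  rewrite (@independent_expectation _ _ _ P (past X x k.+1) _ (p z) _ (C * B z)).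
  - by rewrite mulNr subrr.
  - exact: X_meas.
  - exact: past_measurable.
  - move=> E' FE'; have [_ _ /(_ _ FE') ->] := X_law k.+1 i z.
    by rewrite -(integral_cst P (past_measurable FE')).

  - move=> E' mE'; have := measurable_funM aY (ac k z) measurableT mE'.
    by rewrite setTI.
  - by move=> t; rewrite normrM; apply: ler_pM.
have := martingale_csum G_meas G_incr D_adapted D_bounded D_centered b_sq.
by apply: filterS => t; apply: eq_csum => k; exact: DE.
Qed.

End SamplingNoise.

Section StochasticSaddle.
Context (R : realType) (disp : measure_display) (T : measurableType disp).
Variables (P : probability T R) (m : nat) (G M L : 'M[R]_m) (C : R).
Let n := dim4 m.
Let A : 'M[R]_n := saddle_mx G M L.
Variables (lo hi xs : 'cV[R]_n) (alpha : nat -> R).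
Variables (I : Type) (Z : finType) (X : nat -> I -> T -> Z) (x : nat -> T -> 'cV[R]_n).
Variables (p : Z -> R) (owner : 'I_n -> I) (ghat : 'I_n -> Z -> 'cV[R]_n -> R).

Hypothesis L_sym : L^T = L.
Hypothesis G_ge0 : forall y : 'cV[R]_m, 0 <= dotv (G *m y) y.
Hypothesis G_coercive : forall (y : 'cV[R]_m) c, y c 0 ^+ 2 <= C * dotv (G *m y) y.
Hypothesis xs_box : box lo hi xs.
Hypothesis xs_v : v_of xs = 0.
Hypothesis box_v_nondeg : forall c, lo (idx_v c) 0 < hi (idx_v c) 0.
Hypothesis alpha_gt0 : forall k, 0 < alpha k.
Hypothesis alpha_div : forall k (r : R), exists m, r <= \sum_(k <= i < m) alpha i.
Hypothesis alpha_sq : csum (fun k => alpha k ^+ 2).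
Hypothesis X_meas : forall k i z, measurable (X k i @^-1` [set z]).
Hypothesis x0_meas : forall c, measurable_fun setT (fun t => x 0 t c 0).
Hypothesis X_law : forall k i z,
  is_cond_prob P (past X x k) (X k i @^-1` [set z]) (cst (p z)).
Hypothesis ghat_polyf : forall c z, polyf (ghat c z).
Hypothesis ghat_mean : forall c u, \sum_z p z * ghat c z u = (A *m (u - xs)) c 0.
Hypothesis ghat_v : forall c z u, ghat (idx_v c) z u = (A *m (u - xs)) (idx_v c) 0.
Hypothesis ghat_mu : forall c z u, ghat (idx_mu c) z u = (A *m (u - xs)) (idx_mu c) 0.
Hypothesis xS : forall k t c, x k.+1 t c 0 = clip (lo c 0) (hi c 0)
  (x k t c 0 - alpha k * ghat c (X k (owner c) t) (x k t)).

Lemma clip_measurable (a b : R) (f : T -> R) : measurable_fun setT f ->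
  measurable_fun setT (fun t => clip a b (f t)).
Proof.
move=> mf; apply: measurable_maxr; first exact: measurable_cst.
by apply: measurable_minr => //; exact: measurable_cst.
Qed.

Lemma iterate_measurable k c : measurable_fun setT (fun t => x k t c 0).
Proof.
elim: k c => [|k IH] c; first exact: x0_meas.
under eq_fun do rewrite xS.
apply: clip_measurable; apply: measurable_funB; first exact: IH.
apply: measurable_funM; first exact: measurable_cst.
have -> : (fun t => ghat c (X k (owner c) t) (x k t)) = (fun t =>
    \sum_z \1_(X k (owner c) @^-1` [set z]) t * ghat c z (x k t)).
  apply/funext => t; rewrite (bigD1 (X k (owner c) t)) //= big1 ?addr0 => [|z zX].
    by rewrite indicE mem_set // mul1r.
  by rewrite indicE memNset ?mul0r // => h; move: zX; rewrite -h eqxx.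
apply: measurable_sum => z; apply: measurable_funM; last exact: polyf_measurable.
by apply: measurable_indic; exact: X_meas.
Qed.

Lemma iterate_box k t : box lo hi (x k.+1 t).
Proof. by move=> c; rewrite xS; apply: clip_itv; have := xs_box c; lra. Qed.

Lemma ghat_bounded : exists2 B, 0 <= B &
  forall c z u, box lo hi u -> `|ghat c z u| <= B.
Proof.
have h (cz : 'I_n * Z) : exists b, 0 <= b /\
    forall u, box lo hi u -> `|ghat cz.1 cz.2 u| <= b.
  by have [b b0 hb] := polyf_bounded lo hi (ghat_polyf cz.1 cz.2); exists b.
have [B hB] := choice h; have B0 cz : 0 <= B cz by case: (hB cz).
exists (\sum_cz B cz); first exact: sumr_ge0.
move=> c z u hu; have [_ /(_ u hu) /= h1] := hB (c, z).
by apply: le_trans h1 _; rewrite (bigD1 (c, z)) //= lerDl sumr_ge0.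
Qed.

(** Everything is shifted by one step: [x 0] is arbitrary, whereas every later iterate lies in the
    box and is thus bounded. *)
Theorem stochastic_saddle_convergence :
  {ae P, forall t, exists z : 'cV[R]_n, [/\ box lo hi z,
     forall y, box lo hi y -> dotv (A *m (z - xs)) (z - y) <= 0 &
     tends0 (fun k => dotv (x k.+1 t - z) (x k.+1 t - z))]}.
Proof.
have noise c f : (forall z, polyf (f z)) -> {ae P, forall t, csum (fun k =>
    alpha k.+1 * (f (X k.+1 (owner c) t) (x k.+1 t) - \sum_z p z * f z (x k.+1 t)))}.
  exact: (sampling_noise_csum X_meas iterate_measurable X_law iterate_box alpha_sq).
pose eta t k : 'cV[R]_n := \col_c (alpha k.+1 *
  (ghat c (X k.+1 (owner c) t) (x k.+1 t) - (A *m (x k.+1 t - xs)) c 0)).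
have etaE t k c : eta t k c 0 = alpha k.+1 *
  (ghat c (X k.+1 (owner c) t) (x k.+1 t) - (A *m (x k.+1 t - xs)) c 0).
  by rewrite mxE.
have eta_ae : {ae P, forall t c, csum (fun k => eta t k c 0)}.
  apply: filter_forall => c; have := noise c _ (ghat_polyf c).
  by apply: filterS => t; apply: eq_csum => k; rewrite etaE ghat_mean.
(* The product with a coordinate of the iterate is again a sampling error, that of the polynomial
   [ghat c z u * u c 0]. *)
have eta_x_ae : {ae P, forall t c, csum (fun k => eta t k c 0 * x k.+1 t c 0)}.
  apply: filter_forall => c.
  have pf z : polyf (fun u => ghat c z u * u c 0).
    by apply: polyfM => //; exact: polyf_coord.
  have := noise c _ pf; apply: filterS => t; apply: eq_csum => k; rewrite etaE -ghat_mean.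
  under eq_bigr do rewrite mulrA; rewrite -mulr_suml; ring.
have [B B0 hB] := ghat_bounded.
apply: filterS2 eta_ae eta_x_ae => t eta_csum eta_x_csum.
apply: (@saddle_convergence R m G M L C lo hi xs (fun k => alpha k.+1)
  (fun k => x k.+1 t) (eta t) B) => //.
- by move=> k; exact: iterate_box.
- move=> k r; have [l hl] := alpha_div k.+1 r; exists l.-1.
  move: hl; case: l => [|l] /=; last by rewrite big_add1.
  by rewrite !big_geq.
- by move=> eps /alpha_sq[N HN]; exists N => k l Nk kl;
    have := HN k.+1 l.+1 (leqW Nk) kl; rewrite big_add1.
- move=> k c; rewrite [in LHS]xS etaE; congr clip; by rewrite mulrBr opprB addrA subrK.
- move=> k c; rewrite etaE -mulrDr addrC subrK normrM gtr0_norm // mulrC.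
  by apply: ler_wpM2r; [exact: ltW|apply: hB; exact: iterate_box].
- by apply: csum_sum.
- by move=> k c; rewrite etaE ghat_v subrr mulr0.
- by move=> k c; rewrite etaE ghat_mu subrr mulr0.
Qed.

End StochasticSaddle.

(** * Boxes, step sizes and Kronecker products *)

Section ProjectionOnBox.
Variables (R : realType) (n : nat).

(** [eproj] picks some nearest point, which has to be identified. Clipping is nearest in each
    coordinate separately, so a point with no larger total distance must do as well in every
    coordinate, where the minimizer is unique. *)
Lemma eproj_box (lo hi x : 'cV[R]_n) : (forall c, lo c 0 <= hi c 0) ->
  eproj (box lo hi) x = \col_c clip (lo c 0) (hi c 0) (x c 0).
Proof.
move=> lohi; pose p := \col_c clip (lo c 0) (hi c 0) (x c 0).
have pE c : p c 0 = clip (lo c 0) (hi c 0) (x c 0) by rewrite mxE.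
have pbox : box lo hi p by move=> c; rewrite pE; exact: clip_itv.
have closer y c : box lo hi y -> (x - p) c 0 ^+ 2 <= (x - y) c 0 ^+ 2.
  move=> /(_ c) hy; apply: sqr_le_norm.
  have -> : (x - p) c 0 = x c 0 - p c 0 by rewrite !mxE.
  have -> : (x - y) c 0 = x c 0 - y c 0 by rewrite !mxE.
  by rewrite pE; exact: clip_nearest.
have dotv_sq (z : 'cV[R]_n) : dotv z z = \sum_i z i 0 ^+ 2.
  by apply: eq_bigr => i _; rewrite expr2.
have nearest : [set p | box lo hi p /\
    forall y, box lo hi y -> enorm (x - p) <= enorm (x - y)] p.
  split=> // y hy; rewrite /enorm ler_wsqrtr // !dotv_sq.
  by apply: ler_sum => c _; exact: closer.
rewrite /eproj; case: xgetP => [q _ [qbox qmin]|/(_ p)//].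
apply/colP => c; rewrite -/p pE; apply: clip_unique; first exact: qbox.
have := qmin p pbox; rewrite /enorm ler_sqrt ?dotv_ge0 // !dotv_sq => hsum.
have : (x - q) c 0 ^+ 2 <= (x - p) c 0 ^+ 2.
  move: hsum; rewrite (bigD1 c) //= [X in _ <= X](bigD1 c) //=.
  have : \sum_(i < n | i != c) (x - p) i 0 ^+ 2 <= \sum_(i < n | i != c) (x - q) i 0 ^+ 2.
    by apply: ler_sum => i _; exact: closer.
  lra.
rewrite -(real_normK (num_real ((x - q) c 0))) -(real_normK (num_real ((x - p) c 0))).
rewrite ler_pXn2r ?nnegrE //.
have -> : (x - p) c 0 = x c 0 - p c 0 by rewrite !mxE.
have -> : (x - q) c 0 = x c 0 - q c 0 by rewrite !mxE.
by rewrite pE.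
Qed.

Lemma box_col4 m (lo1 hi1 lo2 hi2 lo3 hi3 lo4 hi4 : 'cV[R]_m) :
  prod4 (box lo1 hi1) (box lo2 hi2) (box lo3 hi3) (box lo4 hi4) =
  box (col4 lo1 lo2 lo3 lo4) (col4 hi1 hi2 hi3 hi4).
Proof.
apply/seteqP; split => u.
  move=> [h1 h2 h3 h4]; apply: idx4P => c; rewrite !col4_idx.
  - by have := h1 c; rewrite theta_ofE.
  - by have := h2 c; rewrite v_ofE.
  - by have := h3 c; rewrite mu_ofE.
  - by have := h4 c; rewrite w_ofE.
move=> h; split=> c.
- by have := h (idx_th c); rewrite !col4_idx theta_ofE.
- by have := h (idx_v c); rewrite !col4_idx v_ofE.
- by have := h (idx_mu c); rewrite !col4_idx mu_ofE.
- by have := h (idx_w c); rewrite !col4_idx w_ofE.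
Qed.

End ProjectionOnBox.

Section StepSizes.
Variables (R : realType) (alpha : nat -> R).
Hypothesis alpha_gt0 : forall k, 0 < alpha k.

Lemma step_sizes_diverge : (\sum_(0 <= k <oo) (alpha k)%:E = +oo)%E ->
  forall k (r : R), exists m, r <= \sum_(k <= i < m) alpha i.
Proof.
move=> hsum k r; apply: contrapT => no.
pose s := \sum_(0 <= i < k) alpha i.
have bound m : \sum_(0 <= i < m) alpha i <= s + `|r|.
  have [mk|km] := leqP m k.
    rewrite /s (big_cat_nat (n := m) (p := k)) //= -addrA lerDl.
    by apply: addr_ge0 => //; apply: sumr_ge0 => i _; exact: ltW.
  rewrite (big_cat_nat (n := k)) ?(ltnW km) //= lerD2l.
  have [//|h] := leP (\sum_(k <= i < m) alpha i) `|r|; case: no; exists m.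
  by apply: le_trans (ler_norm r) _; exact: ltW.
have : (\sum_(0 <= k <oo) (alpha k)%:E <= (s + `|r|)%:E)%E.
  apply: lime_le; first by apply: is_cvg_nneseries => i _ _; rewrite lee_fin ltW.
  by apply: nearW => m; rewrite sumEFin lee_fin.
by rewrite hsum leye_eq.
Qed.

Lemma step_sizes_sq_csum : (\sum_(0 <= k <oo) (alpha k ^+ 2)%:E < +oo)%E ->
  csum (fun k => alpha k ^+ 2).
Proof.
move=> hfin.
have ge0 m : (0 <= m)%N -> xpredT m -> (0 <= (alpha m ^+ 2)%:E)%E.
  by move=> _ _; rewrite lee_fin sqr_ge0.
apply: (@csum_bounded _ _ (fine (\sum_(0 <= k <oo) (alpha k ^+ 2)%:E)%E)).
  by move=> k; rewrite sqr_ge0.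
move=> m; rewrite -lee_fin fineK; last first.
  by rewrite ge0_fin_numE //; apply: nneseries_ge0.
by rewrite -sumEFin; apply: nneseries_lim_ge.
Qed.

End StepSizes.

Section KroneckerBlocks.
Variables (R : realType) (N : nat).

Lemma sum_mxtens p (F : 'I_(N * p) -> R) :
  \sum_k F k = \sum_i \sum_a F (mxtens_index (i, a)).
Proof.
rewrite pair_big /= (reindex (@mxtens_index N p)) /=.
  by apply: eq_bigr => -[i a] _.
by exists (@mxtens_unindex N p) => ? _; rewrite ?mxtens_indexK ?mxtens_unindexK.
Qed.

Lemma tens1_mul p q (K : 'M[R]_(p, q)) (y : 'cV[R]_(N * q)) i a :
  ((1%:M *t K) *m y) (mxtens_index (i, a)) 0 = (K *m blk y i) a 0.
Proof.
rewrite [LHS]mxE sum_mxtens (bigD1 i) //= [X in _ + X]big1 ?addr0; last first.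
  move=> j ji; apply: big1 => b _; rewrite tensmxE mxE eq_sym (negbTE ji).
  by rewrite mulr0n !mul0r.
rewrite [RHS]mxE; apply: eq_bigr => b _.
by rewrite tensmxE [1%:M i i]mxE eqxx mul1r mxE.
Qed.

Lemma tens_1_mul p (K : 'M[R]_N) (y : 'cV[R]_(N * p)) i a :
  ((K *t 1%:M) *m y) (mxtens_index (i, a)) 0 = \sum_j K i j * blk y j a 0.
Proof.
rewrite [LHS]mxE sum_mxtens; apply: eq_bigr => j _.
rewrite (bigD1 a) //= [X in _ + X]big1 ?addr0; last first.
  move=> b ba; rewrite tensmxE [1%:M _ _]mxE eq_sym (negbTE ba).
  by rewrite mulr0n mulr0 mul0r.
by rewrite tensmxE [1%:M a a]mxE eqxx mulr1 mxE.
Qed.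

Lemma stackE q (f : 'I_N -> 'cV[R]_q) i a : stack f (mxtens_index (i, a)) 0 = f i a 0.
Proof. by rewrite mxE mxtens_indexK. Qed.

Lemma blk_stack q (f : 'I_N -> 'cV[R]_q) i : blk (stack f) i = f i.
Proof. by apply/colP => a; rewrite mxE stackE. Qed.

Lemma lap_diffE q (e : rel 'I_N) (y : 'cV[R]_(N * q)) i a :
  (bar_L R q e *m y) (mxtens_index (i, a)) 0 = lap_diff e y i a 0.
Proof.
have LE j : laplacian R e i j = #|nbrs e i|%:R *+ (i == j) - (e i j)%:R.
  by rewrite !mxE; case: eqP => [->|].
rewrite tens_1_mul; under eq_bigr do rewrite LE mulrBl.
have -> : lap_diff e y i a 0 = #|nbrs e i|%:R * blk y i a 0 -
    \sum_(j in nbrs e i) blk y j a 0.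
  by rewrite /lap_diff -summxE !mxE.
rewrite sumrB; congr (_ - _).
  rewrite (bigD1 i) //= eqxx mulr1n [X in _ + X]big1 ?addr0 // => j ji.
  by rewrite eq_sym (negbTE ji) mulr0n mul0r.
rewrite [RHS]big_mkcond /=; apply: eq_bigr => j _; rewrite inE.
by case: (e i j); rewrite ?mul1r ?mul0r.
Qed.

Lemma laplacian_sym (e : rel 'I_N) : symmetric e -> (laplacian R e)^T = laplacian R e.
Proof.
move=> sym; rewrite /laplacian linearB /= tr_diag_mx; congr (_ - _).
by apply/matrixP => i j; rewrite !mxE sym.
Qed.

End KroneckerBlocks.

(** * Expectations over one sample *)

(** This makes the joint policy, a product over agents with different action types, sum to one.
    Passing through [fprod] turns dependent functions into the tagged families to which
    distributivity applies. *)
Lemma sum_prod_dffun (R : comNzRingType) (I : finType) (T_ : I -> finType)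
    (F : forall i, T_ i -> R) :
  \sum_(a : {dffun forall i, T_ i}) \prod_i F i (a i) = \prod_i \sum_b F i b.
Proof.
pose f i : {ffun T_ i -> R} := [ffun b => F i b].
transitivity (\sum_(t : fprod T_) \prod_(i in I) f i (t i)).
  rewrite (reindex (@dffun_of_fprod _ T_)) /=; last exact/onW_bij/dffun_of_fprod_bij.
  by apply: eq_bigr => t _; apply: eq_bigr => i _; rewrite !ffunE.
rewrite big_fprod.
under [RHS]eq_bigr => i _ do rewrite (big_tag (fun i => F i)).
rewrite bigA_distr_big_dep; apply: eq_bigr => g hg; apply: eq_bigr => i _.
by congr untag; apply/funext => b; rewrite ffunE.
Qed.

Section SampleMean.
Variables (R : realType) (N q : nat) (M : mamdp R N) (pi : policies M).
Variables (d : jstate M -> R) (Phi : 'M[R]_(nS M, q)).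
Hypothesis pi_policy : is_policies pi.

Lemma sum_jstate (f : jstate M -> R) : \sum_s f s = \sum_(x < nS M) f (enum_val x).
Proof. by apply: (reindex (fun x : 'I_(nS M) => enum_val x)); exact/onW_bij/enum_val_bij. Qed.

Lemma jpolicy_sum1 s : \sum_a jpolicy pi s a = 1.
Proof.
rewrite /jpolicy (sum_prod_dffun (fun i => @pi i (s i))) big1 // => i _.
by have [] := pi_policy (s i).
Qed.

Lemma Ppi_sum1 x : \sum_y Ppi pi x y = 1.
Proof.
under eq_bigr do rewrite mxE; rewrite exchange_big /=.
rewrite -(jpolicy_sum1 (enum_val x)); apply: eq_bigr => a _.
by rewrite -mulr_suml -(sum_jstate (trans (enum_val x) a)) trans_sum1 mul1r.
Qed.

(** The integrand does not see the action, and summing the action out of the joint law leaves the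
    entries of [Ppi]. *)
Lemma sample_mean (f : jstate M -> jstate M -> R) :
  \sum_z sample_law pi d z * f z.1.1 z.2 =
  \sum_x \sum_y d (enum_val x) * Ppi pi x y * f (enum_val x) (enum_val y).
Proof.
transitivity (\sum_s \sum_s' \sum_a
    d s * jpolicy pi s a * trans s a s' * f s s').
  rewrite -(pair_bigA _ (fun sa s' =>
    d sa.1 * jpolicy pi sa.1 sa.2 * trans sa.1 sa.2 s' * f sa.1 s')) /=.
  rewrite -(pair_bigA _ (fun s a => \sum_s'
    d s * jpolicy pi s a * trans s a s' * f s s')) /=.
  by apply: eq_bigr => s _; rewrite exchange_big.
rewrite sum_jstate; apply: eq_bigr => x _; rewrite sum_jstate; apply: eq_bigr => y _.
rewrite mxE mulr_sumr mulr_suml; apply: eq_bigr => a _; ring.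
Qed.

Lemma featureE x a : feature Phi (enum_val x) a 0 = Phi x a.
Proof. by rewrite !mxE enum_valK. Qed.

Lemma outer_featureE x y (u : 'cV[R]_q) a :
  (feature Phi (enum_val x) *m (feature Phi (enum_val y))^T *m u) a 0 =
  Phi x a * (Phi *m u) y 0.
Proof.
rewrite -mulmxA mxE big_ord_recl big_ord0 addr0 featureE; congr (_ * _).
by rewrite !mxE; apply: eq_bigr => b _; rewrite mxE featureE.
Qed.

Let p := sample_law pi d.
Let D := Dmx d.

Lemma DmxE (u : 'cV[R]_(nS M)) x : (D *m u) x 0 = d (enum_val x) * u x 0.
Proof. by rewrite mul_diag_mx !mxE. Qed.

Lemma mean_phi_phi (u : 'cV[R]_q) a :
  \sum_z p z * (feature Phi z.1.1 *m (feature Phi z.1.1)^T *m u) a 0 =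
  (Phi^T *m D *m Phi *m u) a 0.
Proof.
rewrite (sample_mean (fun s _ => (feature Phi s *m (feature Phi s)^T *m u) a 0)).
rewrite -!mulmxA [RHS]mxE; apply: eq_bigr => x _.
rewrite -mulr_suml -mulr_sumr Ppi_sum1 mulr1 outer_featureE DmxE [Phi^T a x]mxE; ring.
Qed.

Lemma mean_phi_phi' (u : 'cV[R]_q) a :
  \sum_z p z * (feature Phi z.1.1 *m (feature Phi z.2)^T *m u) a 0 =
  (Phi^T *m D *m Ppi pi *m Phi *m u) a 0.
Proof.
rewrite (sample_mean (fun s s' => (feature Phi s *m (feature Phi s')^T *m u) a 0)).
rewrite -!mulmxA [RHS]mxE; apply: eq_bigr => x _.
rewrite DmxE [(Ppi pi *m _) x 0]mxE [Phi^T a x]mxE !mulr_sumr; apply: eq_bigr => y _.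
rewrite outer_featureE; ring.
Qed.

Lemma mean_phi'_phi (u : 'cV[R]_q) a :
  \sum_z p z * (feature Phi z.2 *m (feature Phi z.1.1)^T *m u) a 0 =
  (Phi^T *m (Ppi pi)^T *m D *m Phi *m u) a 0.
Proof.
rewrite (sample_mean (fun s s' => (feature Phi s' *m (feature Phi s)^T *m u) a 0)).
rewrite -!mulmxA [RHS]mxE exchange_big /=; apply: eq_bigr => y _.
rewrite [((Ppi pi)^T *m _) y 0]mxE [Phi^T a y]mxE mulr_sumr; apply: eq_bigr => x _.
rewrite outer_featureE [(Ppi pi)^T y x]mxE DmxE; ring.
Qed.

Lemma mean_reward i a :
  \sum_z p z * (exp_reward pi (z.1.1 i) *: feature Phi z.1.1) a 0 =
  (Phi^T *m D *m reward_vec pi i) a 0.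
Proof.
rewrite (sample_mean (fun s _ => (exp_reward pi (s i) *: feature Phi s) a 0)).
rewrite -!mulmxA [RHS]mxE; apply: eq_bigr => x _.
rewrite -mulr_suml -mulr_sumr Ppi_sum1 mulr1 [X in _ * X = _]mxE featureE DmxE.
by rewrite [Phi^T a x]mxE [reward_vec _ _ _ _]mxE; ring.
Qed.

Hypothesis d_stationary : stationary pi d.

Lemma sample_law_sum1 : \sum_z p z = 1.
Proof.
transitivity (\sum_z p z * (fun _ _ : jstate M => 1 : R) z.1.1 z.2).
  by apply: eq_bigr => z _; rewrite /= mulr1.
rewrite (sample_mean (fun _ _ => 1)); have [_ d1 _] := d_stationary.
rewrite -[RHS]d1 sum_jstate; apply: eq_bigr => x _.
by rewrite -mulr_suml -mulr_sumr Ppi_sum1 !mulr1.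
Qed.

End SampleMean.

Lemma scalar1_tens (R : realType) N p : 1%:M *t 1%:M = 1%:M :> 'M[R]_(N * p).
Proof.
apply/matrixP => k l; case: (mxtens_indexP k) => i a; case: (mxtens_indexP l) => j b.
rewrite tensmxE !mxE (can_eq (@mxtens_indexK N p)) xpair_eqE.
by case: eqP => _; case: eqP => _; rewrite ?mul1r ?mul0r.
Qed.

Lemma tens1_subZ (R : realType) N p (g : R) (K : 'M[R]_p) :
  1%:M - g *: (1%:M *t K) = 1%:M *t (1%:M - g *: K) :> 'M[R]_(N * p).
Proof.
rewrite -[X in X - _]scalar1_tens.
by apply/matrixP => k l; rewrite !mxE; ring.
Qed.

Section GramMatrix.
Variables (R : realType) (N q : nat) (M : mamdp R N).
Variables (d : jstate M -> R) (Phi : 'M[R]_(nS M, q)).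
Hypothesis d_gt0 : forall s, 0 < d s.
Hypothesis Phi_rank : \rank Phi = q.

Let G := (bar_Phi Phi)^T *m bar_D d *m bar_Phi Phi.

Lemma bar_D_sym : (bar_D d)^T = bar_D d.
Proof. by rewrite /bar_D trmx_tens trmx1 /Dmx tr_diag_mx. Qed.

Lemma bar_gramE : G = 1%:M *t (Phi^T *m Dmx d *m Phi).
Proof. by rewrite /G /bar_Phi /bar_D trmx_tens trmx1 !tensmx_mul !mul1mx. Qed.

Lemma gram_quad (u : 'cV[R]_q) :
  dotv (Phi^T *m Dmx d *m Phi *m u) u = \sum_x d (enum_val x) * (Phi *m u) x 0 ^+ 2.
Proof.
rewrite dotvE !trmx_mul trmxK tr_diag_mx -!mulmxA mulmxA -trmx_mul -dotvE.
by apply: eq_bigr => x _; rewrite DmxE; ring.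
Qed.

Lemma dotv_blk (y z : 'cV[R]_(N * q)) : dotv y z = \sum_i dotv (blk y i) (blk z i).
Proof.
by rewrite {1}/dotv sum_mxtens; apply: eq_bigr => i _; apply: eq_bigr => a _; rewrite !mxE.
Qed.

Lemma bar_gram_quad (y : 'cV[R]_(N * q)) : dotv (G *m y) y =
  \sum_i \sum_x d (enum_val x) * (Phi *m blk y i) x 0 ^+ 2.
Proof.
rewrite dotv_blk; apply: eq_bigr => i _; rewrite -gram_quad; congr dotv.
by apply/colP => a; rewrite mxE bar_gramE tens1_mul.
Qed.

Lemma bar_gram_ge0 (y : 'cV[R]_(N * q)) : 0 <= dotv (G *m y) y.
Proof.
rewrite bar_gram_quad; apply: sumr_ge0 => i _; apply: sumr_ge0 => x _.
by rewrite mulr_ge0 ?sqr_ge0 // ltW.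
Qed.

(** Positive weights [d] bound each value of [Phi *m blk y i] by the quadratic form, with [K] the
    sum of the inverse weights. Full column rank gives [Phi] the left inverse [pinvmx Phi], of
    sup-norm constant [B], which recovers [y]. *)
Lemma bar_gram_coercive : exists2 C, 0 <= C & forall (y : 'cV[R]_(N * q)) c,
  y c 0 ^+ 2 <= C * dotv (G *m y) y.
Proof.
have full : row_full Phi by rewrite /row_full Phi_rank.
have [B B0 HB] := mulmx_small (pinvmx Phi).
pose K := \sum_s (d s)^-1.
have dV_ge0 s : 0 <= (d s)^-1 by rewrite invr_ge0 ltW.
have K0 : 0 <= K by apply: sumr_ge0.
exists (B ^+ 2 * K); first by rewrite mulr_ge0 // sqr_ge0.
move=> y c; case: (mxtens_indexP c) => i a.
set h := dotv _ _; have h0 : 0 <= h := bar_gram_ge0 y.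
have small x : `|(Phi *m blk y i) x 0| <= Num.sqrt (K * h).
  rewrite -sqrtr_sqr ler_wsqrtr //; set f := (Phi *m _) x 0.
  have dx := d_gt0 (enum_val x).
  have le_h : d (enum_val x) * f ^+ 2 <= h.
    rewrite /h bar_gram_quad (bigD1 i) //= (bigD1 x) //= -/f -addrA lerDl.
    apply: addr_ge0; apply: sumr_ge0 => j _; last apply: sumr_ge0 => l _;
      by rewrite mulr_ge0 ?sqr_ge0 // ltW.
  apply: (@le_trans _ _ ((d (enum_val x))^-1 * h)).
    by rewrite mulrC ler_pdivlMr // mulrC.
  by rewrite ler_wpM2r // /K (bigD1 (enum_val x)) //= lerDl sumr_ge0.
have := HB _ _ small a; rewrite mulmxA mulVpmx // mul1mx mxE => le_y.
have -> : B ^+ 2 * K * h = (B * Num.sqrt (K * h)) ^+ 2.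
  by rewrite exprMn sqr_sqrtr ?mulr_ge0 // mulrA.
by apply: sqr_le_norm; apply: le_trans le_y (ler_norm _).
Qed.

Lemma bar_gram_unit : G \in unitmx.
Proof.
have [C _ HC] := bar_gram_coercive.
rewrite -row_free_unit -kermx_eq0; apply/eqP/row_matrixP => k; rewrite row0.
set u := row k _.
have uG : u *m G = 0 by apply/sub_kermxP; exact: row_sub.
have symG : G^T = G.
  by rewrite /G !trmx_mul trmxK bar_D_sym mulmxA.
have Gu : G *m u^T = 0 by rewrite -[G]symG -trmx_mul uG trmx0.
apply/rowP => c; have := HC u^T c; rewrite Gu.
have -> : dotv 0 u^T = 0 :> R by rewrite /dotv big1 // => i _; rewrite mxE mul0r.
rewrite mulr0 => le0; have : u^T c 0 ^+ 2 == 0 by rewrite eq_le le0 sqr_ge0.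
by rewrite sqrf_eq0 => /eqP; rewrite !mxE.
Qed.

End GramMatrix.

(** * The drift of DGTD *)

Section CoordinateOwner.
Variables (N q : nat).

Definition block_idx m (c : 'I_(dim4 m)) : 'I_m :=
  match fintype.split c with inl k => k | inr c' =>
    match fintype.split c' with inl k => k | inr c'' =>
      match fintype.split c'' with inl k => k | inr k => k end end end.

Lemma block_idx_th m (c : 'I_m) : block_idx (idx_th c) = c.
Proof. by rewrite /block_idx (unsplitK (@inl _ _ c)). Qed.

Lemma block_idx_w m (c : 'I_m) : block_idx (idx_w c) = c.
Proof.
by rewrite /block_idx (unsplitK (@inr _ _ (rshift m (rshift m c)))) /=
  (unsplitK (@inr _ _ (rshift m c))) /= (unsplitK (@inr _ _ c)).
Qed.

Definition owner (c : 'I_(dim4 (N * q))) : 'I_N := (mxtens_unindex (block_idx c)).1.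

Lemma owner_th i (a : 'I_q) : owner (idx_th (mxtens_index (i, a))) = i.
Proof. by rewrite /owner block_idx_th mxtens_indexK. Qed.

Lemma owner_w i (a : 'I_q) : owner (idx_w (mxtens_index (i, a))) = i.
Proof. by rewrite /owner block_idx_w mxtens_indexK. Qed.

End CoordinateOwner.

Lemma entryD (R : realType) p (x y : 'cV[R]_p) c : (x + y) c 0 = x c 0 + y c 0.
Proof. by rewrite mxE. Qed.

Lemma entryN (R : realType) p (x : 'cV[R]_p) c : (- x) c 0 = - x c 0.
Proof. by rewrite mxE. Qed.

Lemma entryZ (R : realType) p (a : R) (x : 'cV[R]_p) c : (a *: x) c 0 = a * x c 0.
Proof. by rewrite mxE. Qed.

Lemma entry0 (R : realType) p c : (0 : 'cV[R]_p) c 0 = 0.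
Proof. by rewrite mxE. Qed.

Section SampledDrift.
Variables (R : realType) (N q : nat) (M : mamdp R N) (pi : policies M).
Variables (d : jstate M -> R) (Phi : 'M[R]_(nS M, q)) (e : rel 'I_N).
Local Notation gamma := (discount M).
Local Notation L := (bar_L R q e).
Local Notation phi z := (feature Phi z.1.1).
Local Notation phi' z := (feature Phi z.2).

Definition theta_drift (u : 'cV[R]_(dim4 (N * q))) (z : sample M) i : 'cV[R]_q :=
  phi z *m (phi z)^T *m blk (theta_of u) i + phi z *m (phi z)^T *m blk (w_of u) i
  - gamma *: (phi z *m (phi' z)^T *m blk (w_of u) i)
  - exp_reward pi (z.1.1 i) *: phi z.

Definition w_drift (u : 'cV[R]_(dim4 (N * q))) (z : sample M) i : 'cV[R]_q :=
  phi z *m (phi z)^T *m blk (theta_of u) i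
  - gamma *: (phi' z *m (phi z)^T *m blk (theta_of u) i).

(* Each coordinate is meant to be evaluated at the sample of its own agent. *)
Definition sampled_drift (c : 'I_(dim4 (N * q))) (z : sample M)
    (u : 'cV[R]_(dim4 (N * q))) : R :=
  col4 (stack (theta_drift u z)) (v_of u - L *m w_of u) (- (L *m w_of u))
       (L *m v_of u + L *m mu_of u - stack (w_drift u z)) c 0.

Lemma theta_driftE u z i a : theta_drift u z i a 0 =
  (phi z *m (phi z)^T *m blk (theta_of u) i) a 0 +
  (phi z *m (phi z)^T *m blk (w_of u) i) a 0 -
  gamma * (phi z *m (phi' z)^T *m blk (w_of u) i) a 0 -
  (exp_reward pi (z.1.1 i) *: phi z) a 0.
Proof. by rewrite !mxE. Qed.

Lemma w_driftE u z i a : w_drift u z i a 0 =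
  (phi z *m (phi z)^T *m blk (theta_of u) i) a 0 -
  gamma * (phi' z *m (phi z)^T *m blk (theta_of u) i) a 0.
Proof. by rewrite !mxE. Qed.

Lemma sampled_drift_th u z i a :
  sampled_drift (idx_th (mxtens_index (i, a))) z u = theta_drift u z i a 0.
Proof. by rewrite /sampled_drift col4_idx stackE. Qed.

Lemma sampled_drift_v u z c :
  sampled_drift (idx_v c) z u = v_of u c 0 - (L *m w_of u) c 0.
Proof. by rewrite /sampled_drift col4_idx entryD entryN. Qed.

Lemma sampled_drift_mu u z c : sampled_drift (idx_mu c) z u = - (L *m w_of u) c 0.
Proof. by rewrite /sampled_drift col4_idx entryN. Qed.

Lemma sampled_drift_w u z i a :
  sampled_drift (idx_w (mxtens_index (i, a))) z u =
  (L *m v_of u) (mxtens_index (i, a)) 0 + (L *m mu_of u) (mxtens_index (i, a)) 0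
  - w_drift u z i a 0.
Proof.
rewrite /sampled_drift col4_idx; move: (w_drift u z) => W.
by rewrite !(entryD, entryN) stackE.
Qed.

Lemma polyf_sampled_drift c z : polyf (sampled_drift c z).
Proof.
have pth j : polyf (fun u : 'cV[R]_(dim4 (N * q)) => theta_of u j 0).
  by apply: (polyf_ext (fun u => esym (theta_ofE u j))); exact: polyf_coord.
have pv j : polyf (fun u : 'cV[R]_(dim4 (N * q)) => v_of u j 0).
  by apply: (polyf_ext (fun u => esym (v_ofE u j))); exact: polyf_coord.
have pmu j : polyf (fun u : 'cV[R]_(dim4 (N * q)) => mu_of u j 0).
  by apply: (polyf_ext (fun u => esym (mu_ofE u j))); exact: polyf_coord.
have pw j : polyf (fun u : 'cV[R]_(dim4 (N * q)) => w_of u j 0).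
  by apply: (polyf_ext (fun u => esym (w_ofE u j))); exact: polyf_coord.
have pthb i j : polyf (fun u : 'cV[R]_(dim4 (N * q)) => blk (theta_of u) i j 0).
  by apply: polyf_ext (pth (mxtens_index (i, j))) => u; rewrite [RHS]mxE.
have pwb i j : polyf (fun u : 'cV[R]_(dim4 (N * q)) => blk (w_of u) i j 0).
  by apply: polyf_ext (pw (mxtens_index (i, j))) => u; rewrite [RHS]mxE.
move: c; apply: idx4P => c.
- case: (mxtens_indexP c) => i a.
  apply: (polyf_ext (fun u => esym (etrans (sampled_drift_th u z i a) (theta_driftE u z i a)))).
  apply: polyfB; last exact: polyf_cst.
  apply: polyfB; last by apply: polyfM; [exact: polyf_cst|exact: polyf_mulmx].
  by apply: polyfD; exact: polyf_mulmx.
- apply: (polyf_ext (fun u => esym (sampled_drift_v u z c))).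
  by apply: polyfB => //; exact: polyf_mulmx.
- apply: (polyf_ext (fun u => esym (sampled_drift_mu u z c))).
  by apply: polyfN; exact: polyf_mulmx.
- case: (mxtens_indexP c) => i a.
  apply: (polyf_ext (fun u => esym (sampled_drift_w u z i a))).
  apply: polyfB; first by apply: polyfD; exact: polyf_mulmx.
  apply: (polyf_ext (fun u => esym (w_driftE u z i a))).
  apply: polyfB; last apply: polyfM; [exact: polyf_mulmx|exact: polyf_cst|].
  exact: polyf_mulmx.
Qed.

Hypothesis pi_policy : is_policies pi.
Hypothesis d_stationary : stationary pi d.
Hypothesis e_sym : symmetric e.

Local Notation G := ((bar_Phi Phi)^T *m bar_D d *m bar_Phi Phi).
Definition coupling_mx : 'M[R]_(N * q) :=
  (bar_Phi Phi)^T *m bar_D d *m (1%:M - gamma *: bar_P pi) *m bar_Phi Phi.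

Lemma bar_L_sym : L^T = L.
Proof. by rewrite /bar_L trmx_tens trmx1 laplacian_sym. Qed.

Lemma coupling_mxT : coupling_mx^T =
  (bar_Phi Phi)^T *m (1%:M - gamma *: bar_P pi)^T *m bar_D d *m bar_Phi Phi.
Proof. by rewrite /coupling_mx !trmx_mul trmxK bar_D_sym !mulmxA. Qed.

Lemma A_mx_saddle : A_mx pi d Phi e = saddle_mx G coupling_mx L.
Proof. by rewrite /A_mx /saddle_mx coupling_mxT. Qed.

Lemma coupling_mxE : coupling_mx =
  1%:M *t (Phi^T *m Dmx d *m (1%:M - gamma *: Ppi pi) *m Phi).
Proof.
rewrite /coupling_mx /bar_P tens1_subZ /bar_Phi /bar_D trmx_tens trmx1.
by rewrite !tensmx_mul !mul1mx.
Qed.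

Lemma coupling_blk (u : 'cV[R]_(N * q)) i a :
  (coupling_mx *m u) (mxtens_index (i, a)) 0 =
  (Phi^T *m Dmx d *m Phi *m blk u i) a 0
  - gamma * (Phi^T *m Dmx d *m Ppi pi *m Phi *m blk u i) a 0.
Proof.
rewrite coupling_mxE tens1_mul mulmxBr mulmx1 !mulmxBl -scalemxAr -!scalemxAl.
by rewrite entryD entryN entryZ.
Qed.

Lemma couplingT_blk (u : 'cV[R]_(N * q)) i a :
  (coupling_mx^T *m u) (mxtens_index (i, a)) 0 =
  (Phi^T *m Dmx d *m Phi *m blk u i) a 0
  - gamma * (Phi^T *m (Ppi pi)^T *m Dmx d *m Phi *m blk u i) a 0.
Proof.
have -> : coupling_mx^T = 1%:M *t (Phi^T *m (1%:M - gamma *: Ppi pi)^T *m Dmx d *m Phi).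
  by rewrite coupling_mxE trmx_tens trmx1 !trmx_mul trmxK tr_diag_mx !mulmxA.
rewrite tens1_mul linearB linearZ /= trmx1 mulmxBr mulmx1 !mulmxBl -scalemxAr -!scalemxAl.
by rewrite entryD entryN entryZ.
Qed.

Lemma gram_blk (u : 'cV[R]_(N * q)) i a :
  (G *m u) (mxtens_index (i, a)) 0 = (Phi^T *m Dmx d *m Phi *m blk u i) a 0.
Proof. by rewrite bar_gramE tens1_mul. Qed.

Lemma bar_reward_blk i a :
  ((bar_Phi Phi)^T *m bar_D d *m bar_r pi) (mxtens_index (i, a)) 0 =
  (Phi^T *m Dmx d *m reward_vec pi i) a 0.
Proof.
rewrite /bar_Phi /bar_D trmx_tens trmx1 tensmx_mul mul1mx tens1_mul.
by rewrite /bar_r blk_stack.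
Qed.

Local Notation p z := (sample_law pi d z).

(** The sampled drift is unbiased: the outer products of features average to [Phi^T D Phi], to
    [Phi^T D P Phi] and to the transpose of the latter, which are the blocks of [A]. *)
Lemma sampled_drift_mean c u :
  \sum_z p z * sampled_drift c z u = (A_mx pi d Phi e *m u + b_vec pi d Phi) c 0.
Proof.
have avg (g : R) : \sum_z p z * g = g.
  by rewrite -mulr_suml sample_law_sum1 // mul1r.
have -> : (A_mx pi d Phi e *m u + b_vec pi d Phi) c 0 =
    (A_mx pi d Phi e *m u) c 0 + b_vec pi d Phi c 0 by rewrite entryD.
rewrite A_mx_saddle saddle_mulE /b_vec; move: c; apply: idx4P => c; rewrite !col4_idx.
- case: (mxtens_indexP c) => i a.
  under eq_bigr do rewrite sampled_drift_th theta_driftE !mulrBr mulrDr mulrCA.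
  rewrite !sumrB big_split /= -mulr_sumr mean_phi_phi // mean_phi_phi // mean_phi_phi' //.
  rewrite mean_reward // entryD gram_blk coupling_blk.
  by rewrite entryN bar_reward_blk; ring.
- under eq_bigr do rewrite sampled_drift_v.
  by rewrite avg entry0 addr0 entryD entryN.
- under eq_bigr do rewrite sampled_drift_mu.
  by rewrite avg entry0 addr0 entryN.
- case: (mxtens_indexP c) => i a.
  under eq_bigr do rewrite sampled_drift_w w_driftE mulrBr.
  rewrite sumrB avg; under [X in _ - X]eq_bigr do rewrite mulrBr mulrCA.
  rewrite sumrB -mulr_sumr mean_phi_phi // mean_phi'_phi //.
  rewrite entry0 addr0 !(entryD, entryN) couplingT_blk; ring.
Qed.

End SampledDrift.

Section Step.
Variables (R : realType) (N q : nat) (M : mamdp R N) (pi : policies M).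
Variables (Phi : 'M[R]_(nS M, q)) (e : rel 'I_N).
Variables lo_th hi_th lo_v hi_v lo_mu hi_mu lo_w hi_w : 'cV[R]_(N * q).
Hypothesis th_le : forall c, lo_th c 0 <= hi_th c 0.
Hypothesis v_le : forall c, lo_v c 0 <= hi_v c 0.
Hypothesis mu_le : forall c, lo_mu c 0 <= hi_mu c 0.
Hypothesis w_le : forall c, lo_w c 0 <= hi_w c 0.

Local Notation lo := (col4 lo_th lo_v lo_mu lo_w).
Local Notation hi := (col4 hi_th hi_v hi_mu hi_w).

Lemma dgtd_step_coord (alpha : R) u (z : 'I_N -> sample M) c :
  dgtd_step pi Phi e (box lo_th hi_th) (box lo_v hi_v) (box lo_mu hi_mu)
    (box lo_w hi_w) alpha u z c 0 =
  clip (lo c 0) (hi c 0) (u c 0 - alpha * sampled_drift pi Phi e c (z (owner c)) u).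
Proof.
have blkE (y : 'cV[R]_(N * q)) i a : blk y i a 0 = y (mxtens_index (i, a)) 0.
  by rewrite mxE.
rewrite /dgtd_step !eproj_box //; move: c; apply: idx4P => c; rewrite !col4_idx mxE;
  congr clip; case: (mxtens_indexP c) => i a; rewrite stackE.
- rewrite owner_th sampled_drift_th theta_driftE /theta_half.
  by rewrite !(entryD, entryN, entryZ) blkE theta_ofE.
- by rewrite sampled_drift_v lap_diffE /v_half !(entryD, entryN, entryZ) blkE v_ofE.
- rewrite sampled_drift_mu lap_diffE /mu_half !(entryD, entryN, entryZ) blkE mu_ofE.
  by rewrite mulrN opprK.
- rewrite owner_w sampled_drift_w w_driftE !lap_diffE /w_half.
  by rewrite !(entryD, entryN, entryZ) blkE w_ofE; ring.
Qed.

End Step.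

Section ReferencePoint.
Variables (R : realType) (N q : nat) (M : mamdp R N) (pi : policies M).
Variables (d : jstate M -> R) (Phi : 'M[R]_(nS M, q)) (e : rel 'I_N).
Hypothesis d_gt0 : forall s, 0 < d s.
Hypothesis Phi_rank : \rank Phi = q.
Local Notation gamma := (discount M).
Local Notation L := (bar_L R q e).

Lemma bar_L_bar_w w : L *m bar_w N w = 0.
Proof.
apply/colP => c; case: (mxtens_indexP c) => i a; rewrite lap_diffE entry0 /lap_diff.
rewrite /bar_w blk_stack; under eq_bigr do rewrite blk_stack.
by rewrite sumr_const scaler_nat subrr mxE.
Qed.

(** Row by row: [bar_theta] is defined to solve the first block, the Laplacian kills the common
    vector in the next two, and the last block is membership of [mu] in [Fset]. *)
Lemma reference_point_root (w : 'cV[R]_q) mu : Fset pi d Phi e w mu ->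
  A_mx pi d Phi e *m col4 (bar_theta pi d Phi w) 0 mu (bar_w N w) = - b_vec pi d Phi.
Proof.
move=> /= hmu; rewrite A_mx_saddle saddle_mulE !of_col4 bar_L_bar_w mulmx0 hmu.
rewrite /b_vec /col4 !opp_col_mx !oppr0 opprK !addr0 coupling_mxT addNr.
congr col_mx; rewrite /bar_theta !mulmxA mulmxV ?bar_gram_unit // mul1mx.
rewrite /coupling_mx; set F := (bar_Phi Phi)^T *m bar_D d.
rewrite -!(mulmxA F) -mulmxDr; congr (F *m _).
rewrite mulmxBl mul1mx -scalemxAl mulmxBl -scalemxAl.
by rewrite addrACA subrK subrr addr0.
Qed.

End ReferencePoint.

Lemma dist_to_ge0 (R : realType) n (x : 'cV[R]_n) C : (0 <= dist_to x C)%E.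
Proof. by apply: le_ereal_inf_tmp => _ [y _ <-]; rewrite lee_fin sqrtr_ge0. Qed.

Lemma dist_to_tends0 (R : realType) n (x : nat -> 'cV[R]_n) z (C : set 'cV[R]_n) :
  C z -> tends0 (fun k => dotv (x k.+1 - z) (x k.+1 - z)) ->
  dist_to (x k) C @[k --> \oo] --> 0%E.
Proof.
move=> Cz hz.
have enorm0 : enorm (x k - z) @[k --> \oo] --> (0 : R).
  apply/cvgrPdist_le => eps e0; have [K HK] := hz _ (exprn_gt0 2 e0).
  exists K.+1 => // k /=; case: k => // k Kk.
  rewrite sub0r normrN ger0_norm ?sqrtr_ge0 //.
  rewrite -(ger0_norm (ltW e0)) -sqrtr_sqr /enorm ler_wsqrtr //.
  exact: le_trans (ler_norm _) (HK k Kk).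
apply: (@squeeze_cvge _ _ _ _ (fun=> 0%E) _ (fun k => (enorm (x k - z))%:E)).
- apply: nearW => k; rewrite dist_to_ge0 /=; apply: ereal_inf_lbound.
  by exists z.
- exact: cvg_cst.
- by apply: cvg_EFin => //; exact: nearW.
Qed.

Theorem proposition6
  (R : realType) (N q : nat) (M : mamdp R N)
  (pi : policies M) (d : jstate M -> R) (Phi : 'M[R]_(nS M, q))
  (e : rel 'I_N)
  (hN : (0 < N)%N)
  (hpi : is_policies pi)
  (hergodic : ergodic_chain (Ppi pi))
  (hd : stationary pi d) (hd_gt0 : forall s, 0 < d s)
  (hPhi : \rank Phi = q)
  (hgraph : simple_graph e) (hconn : connected_graph e)
  (wstar : 'cV[R]_q) (hwstar : is_wstar pi d Phi wstar)
  (lo_th hi_th lo_v hi_v lo_mu hi_mu lo_w hi_w : 'cV[R]_(N * q))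
  (* the intervals of the box of [v] are not reduced to a point *)
  (hbox_v : forall c, lo_v c 0 < hi_v c 0)
  (hC_th : box lo_th hi_th (bar_theta pi d Phi wstar))
  (hC_v : box lo_v hi_v 0)
  (hC_w : box lo_w hi_w (bar_w N wstar))
  (hC_mu : box lo_mu hi_mu `&` Fset pi d Phi e wstar !=set0)
  (alpha : nat -> R)
  (halpha_gt0 : forall k, 0 < alpha k)
  (halpha_sum : (\sum_(0 <= k <oo) (alpha k)%:E = +oo)%E)
  (halpha_sum2 : (\sum_(0 <= k <oo) (alpha k ^+ 2)%:E < +oo)%E)
  (disp : measure_display) (Omega : measurableType disp)
  (Prob : probability Omega R)
  (x0 : Omega -> 'cV[R]_(dim4 (N * q)))
  (hx0 : forall c, measurable_fun setT (fun t => x0 t c 0))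
  (X : nat -> 'I_N -> Omega -> sample M)
  (hX_meas : forall k i z, measurable (X k i @^-1` [set z]))
  (x : nat -> Omega -> 'cV[R]_(dim4 (N * q)))
  (hx : x = dgtd pi Phi e (box lo_th hi_th) (box lo_v hi_v)
              (box lo_mu hi_mu) (box lo_w hi_w) alpha x0 X)
  (hX_law : forall k i z,
     is_cond_prob Prob (past X x k) (X k i @^-1` [set z])
       (cst (sample_law pi d z))) :
  let C := prod4 (box lo_th hi_th) (box lo_v hi_v)
             (box lo_mu hi_mu) (box lo_w hi_w) in
  {ae Prob, forall t,
     dist_to (x k t) (stationary_points pi d Phi e C) @[k --> \oo] --> 0%E}.
Proof.
move=> C; have [mu [mu_box muF]] := hC_mu; have [e_sym _] := hgraph.
have [K _ coercive] := bar_gram_coercive hd_gt0 hPhi.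
pose lo := col4 lo_th lo_v lo_mu lo_w; pose hi := col4 hi_th hi_v hi_mu hi_w.
(* A zero of [A x + b] inside [C], its [mu] block taken from [hC_mu]; it lets the affine drift be
   written [A (x - xs)]. *)
pose xs := col4 (bar_theta pi d Phi wstar) 0 mu (bar_w N wstar).
have CE : C = box lo hi by rewrite /C box_col4.
have xs_box : box lo hi xs.
  by rewrite -CE; split; rewrite /= of_col4.
have Axs := reference_point_root hd_gt0 hPhi muF.
have driftE u : A_mx pi d Phi e *m (u - xs) = A_mx pi d Phi e *m u + b_vec pi d Phi.
  by rewrite mulmxBr Axs opprK.
have lohi c : lo c 0 <= hi c 0 by have := xs_box c; lra.
have coord k t c : x k.+1 t c 0 = clip (lo c 0) (hi c 0)
    (x k t c 0 - alpha k * sampled_drift pi Phi e c (X k (owner c) t) (x k t)).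
  rewrite hx /= dgtd_step_coord // => i.
  - by have := lohi (idx_th i); rewrite !col4_idx.
  - by have := lohi (idx_v i); rewrite !col4_idx.
  - by have := lohi (idx_mu i); rewrite !col4_idx.
  - by have := lohi (idx_w i); rewrite !col4_idx.
have mean c u : \sum_z sample_law pi d z * sampled_drift pi Phi e c z u =
    (saddle_mx ((bar_Phi Phi)^T *m bar_D d *m bar_Phi Phi)
       (coupling_mx pi d Phi) (bar_L R q e) *m (u - xs)) c 0.
  by rewrite sampled_drift_mean // -A_mx_saddle driftE.
have xs_v : v_of xs = 0 by rewrite of_col4.
have drift_v c z u : sampled_drift pi Phi e (idx_v c) z u =
    (saddle_mx ((bar_Phi Phi)^T *m bar_D d *m bar_Phi Phi)
       (coupling_mx pi d Phi) (bar_L R q e) *m (u - xs)) (idx_v c) 0.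
  rewrite -A_mx_saddle driftE entryD A_mx_saddle saddle_mulE !col4_idx entry0 addr0.
  by rewrite sampled_drift_v entryD entryN.
have drift_mu c z u : sampled_drift pi Phi e (idx_mu c) z u =
    (saddle_mx ((bar_Phi Phi)^T *m bar_D d *m bar_Phi Phi)
       (coupling_mx pi d Phi) (bar_L R q e) *m (u - xs)) (idx_mu c) 0.
  rewrite -A_mx_saddle driftE entryD A_mx_saddle saddle_mulE !col4_idx entry0 addr0.
  by rewrite sampled_drift_mu entryN.
have nondeg c : lo (idx_v c) 0 < hi (idx_v c) 0 by rewrite !col4_idx.
have x0_meas c : measurable_fun setT (fun t => x 0 t c 0) by rewrite hx; exact: hx0.
have := @stochastic_saddle_convergence R _ _ Prob _ _ (coupling_mx pi d Phi)
  (bar_L R q e) K lo hi xs alpha _ _ X x (sample_law pi d) (@owner N q)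
  (sampled_drift pi Phi e) (bar_L_sym _ _ e_sym) (bar_gram_ge0 Phi hd_gt0) coercive xs_box xs_v
  nondeg halpha_gt0 (step_sizes_diverge halpha_gt0 halpha_sum)
  (step_sizes_sq_csum halpha_sum2) hX_meas x0_meas hX_law
  (polyf_sampled_drift pi Phi e) mean drift_v drift_mu coord.
apply: filterS => t [z [zbox VI zlim]]; apply: dist_to_tends0 zlim.
split=> [|y]; first by rewrite CE.
(* As [A (z - xs) = A z + b], the variational inequality at [z] is exactly the normal cone
   condition. *)
rewrite CE => /VI; rewrite -A_mx_saddle driftE -[z - y]opprB dotvNr -dotvNl.
by rewrite opprD.
Qed.
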